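(* For data $f\in\mathbb R^n$, the $L^1$-Potts algorithm (described in the context, applied with all weights equal) computes an exact minimizer $u\in\mathbb R^n$ of the discrete $L^1$-Potts functional $$P_\gamma(u)=\gamma J(u)+\sum_{i=1}^n|u_i-f_i|$$ within $O(n^2)$ time and $O(n)$ space.
   Context: $\gamma>0$ is a parameter and $J(u)=\#\{i: u_i\ne u_{i+1}\}$ for a vector $u$. Time counts arithmetic operations, comparisons and pointer operations on reals/indices at unit cost with exact real arithmetic; space counts stored reals, indices and pointers. For data $f\in\mathbb R^n$ and positive weights $w$ (here $w_i=1$ for all $i$), a weighted median of $f_{[\ell,r]}=(f_\ell,\ldots,f_r)$ is a minimizer of $y\mapsto\sum_{i=\ell}^r w_i|f_i-y|$, and $d_{[\ell,r]}$ denotes the minimal value. The $L^1$-Potts algorithm, with input $f\in\mathbb R^n$, $w\in\mathbb R_{>0}^n$, $\gamma$: It maintains an indexed linked histogram $H$, i.e. a doubly linked list of nodes sorted by value, one node for each distinct value among the data inserted so far, each storing the value, the accumulated weight of the data with that value, and in addition a temporary weight and temporary next/previous pointers; an array $I$ stores for each data index $i$ a pointer to the node with value $f_i$. Set $P_0=-\gamma$. For $r=1,\ldots,n$: (1) set $P_r=\infty$; insert $f_r$ with weight $w_r$ into $H$ by linear search (creating a node if necessary) and set $I_r$; (2) reset all temporary weights and pointers to the permanent ones; find a median node $M$ of $H$ by traversing the list, and compute $d=d_{[1,r]}$ by summation; (3) for $\ell=1,\ldots,r$: set $p=P_{\ell-1}+\gamma+d$; if $p\le P_r$, set $P_r=p$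 and $Z_r=\ell-1$; then subtract $w_\ell$ from the temporary weight of the node pointed to by $I_\ell$, remove that node from the temporary list if its temporary weight becomes $0$, and shift $M$ step by step along the temporary list until it is a median node of the temporary histogram, updating $d$ along with each shift (so that $d=d_{[\ell+1,r]}$). Finally, the output $u$ is reconstructed from $Z$: with $m_0=n$, $m_{t+1}=Z_{m_t}$, until reaching $0$, $u$ is set on each block of indices $m_{t+1}+1,\ldots,m_t$ to a weighted median of the data on that block. *)

(* Defs.v *)
From HB Require Import structures.
From mathcomp Require Import all_boot all_order all_algebra.
From mathcomp Require Import reals.

Set Implicit Arguments.
Unset Strict Implicit.
Unset Printing Implicit Defensive.

Import Order.TTheory GRing.Theory Num.Theory.

Section Functional.
Local Open Scope ring_scope.

Definition jumps (R : realDomainType) (n : nat) (u : 'rV[R]_n) : nat :=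
  #|[set i : 'I_n | [exists j : 'I_n, (j == i.+1 :> nat) && (u 0 i != u 0 j)]]|.

Definition potts_L1 (R : realDomainType) (n : nat) (gamma : R)
    (f u : 'rV[R]_n) : R :=
  gamma * (jumps u)%:R + \sum_(i < n) `|u 0 i - f 0 i|.

End Functional.

(* A real RAM: a small imperative language with scalar variables, arrays and a
   heap of list nodes.  A memory cell holds one real (or the symbol +oo), one
   index, or one pointer.  Expressions and programs are syntax, so that no
   computation escapes the cost accounting in [exec]. *)

Inductive val (R : Type) : Type :=
  | Real of R
  | Infinity
  | Idx of nat
  | Ptr of option nat.   (* [Ptr None] is the null pointer *)
Arguments Infinity {R}.
Arguments Idx {R} _.
Arguments Ptr {R} _.

(* [dist_] is the running value d of the algorithm, [total_] the total weight
   of the histogram, and [below_], [above_] the temporary weights carried by the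
   nodes of value smaller, respectively larger, than that of the node [med_]. *)
Inductive var : Set :=
  | n_ | gamma_ | r_ | l_ | head_ | cur_ | prv_ | new_ | med_ | nxt_
  | total_ | below_ | above_ | dist_ | cand_
  | lo_ | hi_ | i_ | j_ | best_ | argbest_.

Inductive arr : Set := F_ | W_ | P_ | Z_ | I_ | U_.

Inductive field : Set :=
  value_ | weight_ | next_ | prev_ | tweight_ | tnext_ | tprev_.

Definition vars : seq var :=
  [:: n_; gamma_; r_; l_; head_; cur_; prv_; new_; med_; nxt_; total_;
      below_; above_; dist_; cand_; lo_; hi_; i_; j_; best_; argbest_].
Definition arrs : seq arr := [:: F_; W_; P_; Z_; I_; U_].
Definition fields : seq field :=
  [:: value_; weight_; next_; prev_; tweight_; tnext_; tprev_].

Scheme Equality for var.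
Scheme Equality for arr.
Scheme Equality for field.

Fact var_eqP : Equality.axiom var_beq.
Proof. by case; case; constructor. Qed.
Fact arr_eqP : Equality.axiom arr_beq.
Proof. by case; case; constructor. Qed.
Fact field_eqP : Equality.axiom field_beq.
Proof. by case; case; constructor. Qed.
HB.instance Definition _ := hasDecEq.Build var var_eqP.
HB.instance Definition _ := hasDecEq.Build arr arr_eqP.
HB.instance Definition _ := hasDecEq.Build field field_eqP.

Fact mem_vars (x : var) : x \in vars. Proof. by case: x. Qed.
Fact mem_arrs (a : arr) : a \in arrs. Proof. by case: a. Qed.
Fact mem_fields (fd : field) : fd \in fields. Proof. by case: fd. Qed.

Inductive expr : Set :=
  | Var of var
  | Num of nat
  | Zero                       (* the real number 0 *)
  | Infty
  | Null
  | Read of arr & expr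
  | Get of expr & field
  | Add of expr & expr
  | Sub of expr & expr
  | Mul of expr & expr
  | Abs of expr.

Inductive bexpr : Set :=
  | Le of expr & expr
  | Eq of expr & expr
  | Not of bexpr
  | And of bexpr & bexpr
  | Or of bexpr & bexpr.

Inductive cmd : Set :=
  | Skip
  | Assign of expr & expr      (* the left-hand side must be an l-value *)
  | New of var
  | Alloc of arr & expr
  | Seq of cmd & cmd
  | If of bexpr & cmd & cmd
  | While of bexpr & cmd.

Record store (R : Type) : Type := Store {
  env : var -> val R;
  arrays : arr -> seq (val R);
  heap : seq (field -> val R)
}.

Definition upd (T : eqType) (S : Type) (g : T -> S) (x : T) (v : S) : T -> S :=
  fun y => if y == x then v else g y.

Section Semantics.
Variable R : realDomainType.
Implicit Types (s : store R) (e : expr) (b : bexpr) (c : cmd) (v : val R).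

Definition val_add v1 v2 : option (val R) :=
  match v1, v2 with
  | Real x, Real y => Some (Real (x + y)%R)
  | Idx k, Idx m => Some (Idx (k + m))
  | _, _ => None
  end.

(* On indices this is the truncated subtraction. *)
Definition val_sub v1 v2 : option (val R) :=
  match v1, v2 with
  | Real x, Real y => Some (Real (x - y)%R)
  | Idx k, Idx m => Some (Idx (k - m))
  | _, _ => None
  end.

Definition val_mul v1 v2 : option (val R) :=
  match v1, v2 with
  | Real x, Real y => Some (Real (x * y)%R)
  | _, _ => None
  end.

Definition val_abs v : option (val R) :=
  if v is Real x then Some (Real `|x|%R) else None.

Definition val_le v1 v2 : option bool :=
  match v1, v2 with
  | Real x, Real y => Some (x <= y)%R
  | Real _, Infinity | Infinity, Infinity => Some true
  | Infinity, Real _ => Some false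
  | Idx k, Idx m => Some (k <= m)
  | _, _ => None
  end.

Definition val_eq v1 v2 : option bool :=
  match v1, v2 with
  | Real x, Real y => Some (x == y)
  | Idx k, Idx m => Some (k == m)
  | Ptr p, Ptr q => Some (p == q)
  | _, _ => None
  end.

Definition bind2 (S T : Type) (g : S -> S -> option T) (x y : option S) :=
  if x is Some a then if y is Some b then g a b else None else None.

Fixpoint eval s e : option (val R) :=
  match e with
  | Var x => Some (env s x)
  | Num k => Some (Idx k)
  | Zero => Some (Real 0%R)
  | Infty => Some Infinity
  | Null => Some (Ptr None)
  | Read a e1 =>
      if eval s e1 is Some (Idx k) then onth (arrays s a) k else None
  | Get e1 fd =>
      if eval s e1 is Some (Ptr (Some k))
      then omap (fun node => node fd) (onth (heap s) k) else None
  | Add e1 e2 => bind2 val_add (eval s e1) (eval s e2)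
  | Sub e1 e2 => bind2 val_sub (eval s e1) (eval s e2)
  | Mul e1 e2 => bind2 val_mul (eval s e1) (eval s e2)
  | Abs e1 => obind val_abs (eval s e1)
  end.

(* [And] and [Or] evaluate their second argument only when needed. *)
Fixpoint test s b : option bool :=
  match b with
  | Le e1 e2 => bind2 val_le (eval s e1) (eval s e2)
  | Eq e1 e2 => bind2 val_eq (eval s e1) (eval s e2)
  | Not b1 => omap negb (test s b1)
  | And b1 b2 =>
      if test s b1 is Some t then if t then test s b2 else Some false else None
  | Or b1 b2 =>
      if test s b1 is Some t then if t then Some true else test s b2 else None
  end.

Definition set_var s x v := Store (upd (env s) x v) (arrays s) (heap s).
Definition set_arr s a t := Store (env s) (upd (arrays s) a t) (heap s).
Definition set_heap s h := Store (env s) (arrays s) h.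

(* Fresh cells hold the null pointer. *)
Definition blank_node : field -> val R := fun _ => Ptr None.

Definition assign s (lhs : expr) v : option (store R) :=
  match lhs with
  | Var x => Some (set_var s x v)
  | Read a e1 =>
      if eval s e1 is Some (Idx k) then
        if k < size (arrays s a)
        then Some (set_arr s a (set_nth v (arrays s a) k v)) else None
      else None
  | Get e1 fd =>
      if eval s e1 is Some (Ptr (Some k)) then
        if onth (heap s) k is Some node
        then Some (set_heap s (set_nth blank_node (heap s) k (upd node fd v)))
        else None
      else None
  | _ => None
  end.

(* Every operator, memory access and constant of an expression costs one unit;
   short-circuiting is not credited. *)
Fixpoint ecost e : nat :=
  match e with
  | Var _ | Num _ | Zero | Infty | Null => 1
  | Read _ e1 | Get e1 _ | Abs e1 => (ecost e1).+1
  | Add e1 e2 | Sub e1 e2 | Mul e1 e2 => (ecost e1 + ecost e2).+1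
  end.

Fixpoint bcost b : nat :=
  match b with
  | Le e1 e2 | Eq e1 e2 => (ecost e1 + ecost e2).+1
  | Not b1 => (bcost b1).+1
  | And b1 b2 | Or b1 b2 => (bcost b1 + bcost b2).+1
  end.

(* Number of cells in use, the input and the output included. *)
Definition space s : nat :=
  size vars + \sum_(a <- arrs) size (arrays s a) + size fields * size (heap s).

(* [exec c s s' t m]: started in [s], the program [c] terminates in [s'] after
   [t] units of time, and [m] is the maximal space of the stores met. *)
Inductive exec : cmd -> store R -> store R -> nat -> nat -> Prop :=
  | ExecSkip s : exec Skip s s 0 (space s)
  | ExecAssign s s' e1 e2 v :
      eval s e2 = Some v -> assign s e1 v = Some s' ->
      exec (Assign e1 e2) s s' (ecost e1 + ecost e2).+1
           (maxn (space s) (space s'))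
  | ExecNew s s' x :
      s' = set_heap (set_var s x (Ptr (Some (size (heap s)))))
                    (rcons (heap s) blank_node) ->
      exec (New x) s s' (size fields).+1 (maxn (space s) (space s'))
  | ExecAlloc s s' a e k :
      eval s e = Some (Idx k) -> s' = set_arr s a (nseq k (Ptr None)) ->
      exec (Alloc a e) s s' (ecost e + k).+1 (maxn (space s) (space s'))
  | ExecSeq c1 c2 s s1 s2 t1 t2 m1 m2 :
      exec c1 s s1 t1 m1 -> exec c2 s1 s2 t2 m2 ->
      exec (Seq c1 c2) s s2 (t1 + t2) (maxn m1 m2)
  | ExecIf b c1 c2 s s' t m (q : bool) :
      test s b = Some q -> exec (if q then c1 else c2) s s' t m ->
      exec (If b c1 c2) s s' (bcost b + t).+1 m
  | ExecWhileFalse b c s :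
      test s b = Some false ->
      exec (While b c) s s (bcost b).+1 (space s)
  | ExecWhileTrue b c s s1 s2 t1 t2 m1 m2 :
      test s b = Some true ->
      exec c s s1 t1 m1 -> exec (While b c) s1 s2 t2 m2 ->
      exec (While b c) s s2 (bcost b + t1 + t2).+1 (maxn m1 m2).

Fact exec_deterministic c s s1 s2 t1 t2 m1 m2 :
  exec c s s1 t1 m1 -> exec c s s2 t2 m2 -> [/\ s1 = s2, t1 = t2 & m1 = m2].
Proof.
move=> E1; elim: E1 s2 t2 m2 => {c s s1 t1 m1}.
- by move=> s s2 t2 m2 E; inversion E.
- move=> s s' e1 e2 v ev asg s2 t2 m2 E; inversion E; subst.
  have ? : v = v0 by congruence.
  by subst; have -> : s' = s2 by congruence.
- by move=> s s' x -> s2 t2 m2 E; inversion E; subst.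
- move=> s s' a e k ev -> s2 t2 m2 E; inversion E; subst.
  by have -> : k = k0 by congruence.
- move=> c1 c2 s s1 s2 t1 t2 m1 m2 _ IH1 _ IH2 s3 t3 m3 E; inversion E; subst.
  case: (IH1 _ _ _ ltac:(eassumption)) => ? ? ?; subst.
  by case: (IH2 _ _ _ ltac:(eassumption)) => -> -> ->.
- move=> b c1 c2 s s' t m q tq _ IH s2 t2 m2 E; inversion E; subst.
  have ? : q = q0 by congruence.
  by subst; case: (IH _ _ _ ltac:(eassumption)) => -> -> ->.
- by move=> b c s tb s2 t2 m2 E; inversion E; subst => //; congruence.
- move=> b c s s1 s2 t1 t2 m1 m2 tb _ IH1 _ IH2 s3 t3 m3 E.
  inversion E; subst; first by congruence.
  case: (IH1 _ _ _ ltac:(eassumption)) => ? ? ?; subst.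
  by case: (IH2 _ _ _ ltac:(eassumption)) => -> -> ->.
Qed.

End Semantics.

Declare Scope prog_scope.
Delimit Scope prog_scope with prog.
Bind Scope prog_scope with expr.
Bind Scope prog_scope with bexpr.
Bind Scope prog_scope with cmd.

Coercion Var : var >-> expr.
Coercion Num : nat >-> expr.

Notation "a .[ e ]" := (Read a e) : prog_scope.
Notation "e ~> fd" := (Get e fd)
  (at level 2, left associativity, format "e ~> fd") : prog_scope.
Notation "e1 + e2" := (Add e1 e2) : prog_scope.
Notation "e1 - e2" := (Sub e1 e2) : prog_scope.
Notation "e1 * e2" := (Mul e1 e2) : prog_scope.
Notation "`| e |" := (Abs e) : prog_scope.
Notation "e1 <= e2" := (Le e1 e2) : prog_scope.
Notation "e1 < e2" := (Not (Le e2 e1)) : prog_scope.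
Notation "e1 == e2" := (Eq e1 e2) : prog_scope.
Notation "e1 != e2" := (Not (Eq e1 e2)) : prog_scope.
Notation "b1 && b2" := (And b1 b2) : prog_scope.
Notation "b1 || b2" := (Or b1 b2) : prog_scope.
Notation "e1 <~ e2" := (Assign e1 e2) (at level 75) : prog_scope.
Notation "c1 ;; c2" := (Seq c1 c2)
  (at level 100, right associativity) : prog_scope.

Section Program.
Local Open Scope prog_scope.

Definition For (x : var) (a b : expr) (c : cmd) : cmd :=
  x <~ a ;; While (x <= b) (c ;; x <~ x + 1%N).

(* Indices run from 1 as in the mathematics, while array cells are numbered
   from 0: the cell of index k - 1 in F_, W_, I_, Z_, U_ belongs to the k-th
   datum.  The cell of index k in P_ holds P_k, for k = 0, ..., n. *)

Definition insert_datum : cmd :=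
  cur_ <~ head_ ;;
  prv_ <~ Null ;;
  While ((cur_ != Null) && (cur_~>value_ < F_.[r_ - 1%N])) (
    prv_ <~ cur_ ;;
    cur_ <~ cur_~>next_) ;;
  If ((cur_ != Null) && (cur_~>value_ == F_.[r_ - 1%N])) (
    cur_~>weight_ <~ cur_~>weight_ + W_.[r_ - 1%N] ;;
    I_.[r_ - 1%N] <~ cur_
  ) (
    New new_ ;;
    new_~>value_ <~ F_.[r_ - 1%N] ;;
    new_~>weight_ <~ W_.[r_ - 1%N] ;;
    new_~>prev_ <~ prv_ ;;
    new_~>next_ <~ cur_ ;;
    If (prv_ == Null) (head_ <~ new_) (prv_~>next_ <~ new_) ;;
    If (cur_ == Null) Skip (cur_~>prev_ <~ new_) ;;
    I_.[r_ - 1%N] <~ new_).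

Definition reset_temporary : cmd :=
  total_ <~ Zero ;;
  cur_ <~ head_ ;;
  While (cur_ != Null) (
    cur_~>tweight_ <~ cur_~>weight_ ;;
    cur_~>tnext_ <~ cur_~>next_ ;;
    cur_~>tprev_ <~ cur_~>prev_ ;;
    total_ <~ total_ + cur_~>weight_ ;;
    cur_ <~ cur_~>next_).

Definition find_median : cmd :=
  med_ <~ head_ ;;
  below_ <~ Zero ;;
  above_ <~ total_ - med_~>weight_ ;;
  While (below_ + med_~>weight_ < above_) (
    below_ <~ below_ + med_~>weight_ ;;
    med_ <~ med_~>next_ ;;
    above_ <~ above_ - med_~>weight_).

Definition sum_distances : cmd :=
  dist_ <~ Zero ;;
  cur_ <~ head_ ;;
  While (cur_ != Null) (
    dist_ <~ dist_ + cur_~>weight_ * `|cur_~>value_ - med_~>value_| ;;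
    cur_ <~ cur_~>next_).

Definition remove_datum : cmd :=
  cur_ <~ I_.[l_ - 1%N] ;;
  cur_~>tweight_ <~ cur_~>tweight_ - W_.[l_ - 1%N] ;;
  dist_ <~ dist_ - W_.[l_ - 1%N] * `|cur_~>value_ - med_~>value_| ;;
  If (cur_~>value_ < med_~>value_) (below_ <~ below_ - W_.[l_ - 1%N]) Skip ;;
  If (med_~>value_ < cur_~>value_) (above_ <~ above_ - W_.[l_ - 1%N]) Skip ;;
  If (cur_~>tweight_ == Zero) (
    If (cur_~>tprev_ == Null) Skip (cur_~>tprev_~>tnext_ <~ cur_~>tnext_) ;;
    If (cur_~>tnext_ == Null) Skip (cur_~>tnext_~>tprev_ <~ cur_~>tprev_)
  ) Skip.

(* The node [med_] fails to be a median node of a nonempty temporary histogram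
   when one side outweighs the rest, or when it has itself been removed (its
   temporary pointers then still lead to its former neighbours). *)
Definition shift_median : cmd :=
  While ((below_ + med_~>tweight_ < above_)
         || (above_ + med_~>tweight_ < below_)
         || (med_~>tweight_ == Zero) && (Zero < below_ + above_)) (
    If (below_ <= above_) (
      nxt_ <~ med_~>tnext_ ;;
      dist_ <~ dist_ + (below_ + med_~>tweight_ - above_)
                     * (nxt_~>value_ - med_~>value_) ;;
      below_ <~ below_ + med_~>tweight_ ;;
      above_ <~ above_ - nxt_~>tweight_
    ) (
      nxt_ <~ med_~>tprev_ ;;
      dist_ <~ dist_ + (above_ + med_~>tweight_ - below_)
                     * (med_~>value_ - nxt_~>value_) ;;
      above_ <~ above_ + med_~>tweight_ ;;
      below_ <~ below_ - nxt_~>tweight_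
    ) ;;
    med_ <~ nxt_).

Definition compute_P_Z : cmd :=
  P_.[0%N] <~ Zero - gamma_ ;;
  head_ <~ Null ;;
  For r_ 1%N n_ (
    P_.[r_] <~ Infty ;;
    insert_datum ;;
    reset_temporary ;;
    find_median ;;
    sum_distances ;;
    For l_ 1%N r_ (
      cand_ <~ P_.[l_ - 1%N] + gamma_ + dist_ ;;
      If (cand_ <= P_.[r_]) (
        P_.[r_] <~ cand_ ;;
        Z_.[r_ - 1%N] <~ l_ - 1%N
      ) Skip ;;
      remove_datum ;;
      shift_median)).

(* A weighted median of the data of index lo_ + 1, ..., hi_ is obtained by
   comparing the weighted distances of all data of the block. *)
Definition block_median : cmd :=
  best_ <~ Infty ;;
  For i_ (lo_ + 1%N) hi_ (
    dist_ <~ Zero ;;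
    For j_ (lo_ + 1%N) hi_ (
      dist_ <~ dist_ + W_.[j_ - 1%N] * `|F_.[j_ - 1%N] - F_.[i_ - 1%N]|) ;;
    If (dist_ < best_) (
      best_ <~ dist_ ;;
      argbest_ <~ F_.[i_ - 1%N]
    ) Skip).

Definition reconstruct : cmd :=
  hi_ <~ n_ ;;
  While (0%N < hi_) (
    lo_ <~ Z_.[hi_ - 1%N] ;;
    block_median ;;
    For i_ (lo_ + 1%N) hi_ (U_.[i_ - 1%N] <~ argbest_) ;;
    hi_ <~ lo_).

Definition potts_algorithm : cmd :=
  Alloc P_ (n_ + 1%N) ;;
  Alloc Z_ n_ ;;
  Alloc I_ n_ ;;
  Alloc U_ n_ ;;
  compute_P_Z ;;
  reconstruct.

End Program.

Definition real_cells (R : Type) (k : nat) (x : 'rV[R]_k) : seq (val R) :=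
  [seq Real (x ord0 p) | p <- enum 'I_k].

Definition input_store (R : Type) (k : nat) (f w : 'rV[R]_k) (g : R) :
    store R :=
  {| env := fun x => match x with
                     | n_ => Idx k
                     | gamma_ => Real g
                     | _ => Ptr None
                     end;
     arrays := fun a => match a with
                        | F_ => real_cells f
                        | W_ => real_cells w
                        | _ => [::]
                        end;
     heap := [::] |}.

Definition output (R : Type) (k : nat) (s : store R) (u : 'rV[R]_k) : Prop :=
  arrays s U_ = real_cells u.

(* Main.v *)
(* Dynamic programming: if the least cost P_r of a segmentation of the first r
   data satisfies P_r = min_{l < r} P_l + gamma + d_[l+1, r], with P_0 = -gamma,
   then P_n is the minimum of the functional, and the segmentation recorded in
     Z,
   with a median of the data on each block, attains it.  The loop over l obtains
   the deviations d_[l+1, r] by removing one datum at a time from the histogram;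
   as all weights are 1, the median inequalities are violated by at most one
     unit
   after a removal, so a single shift to a neighbouring node restores them,
     which
   makes the inner loop linear.  Reconstructing a block of length b takes O(b^2)
   steps, and the sum of the b^2 is at most n^2.

   All sums and counts range over the data, never over list nodes; the linked
   list is described by the order of the values alone: the successor of a node
     is
   the node of least larger value. *)
From Pilot Require Import Defs.
From mathcomp Require Import all_boot all_order all_algebra.
From mathcomp Require Import reals zify ring lra.

Set Implicit Arguments.
Unset Strict Implicit.
Unset Printing Implicit Defensive.

Import Order.TTheory GRing.Theory Num.Theory.
(* MathComp shadows [val], [space] and [Real]. *)
Import Pilot.Defs.

#[local] Arguments upd _ _ _ _ _ /.

(** The obstacle is the pointer program rather than the optimization. Loop-free code is executed
    symbolically by [straight], loops carry an invariant and a time budget, and what a command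
    leaves alone is read off its syntax ([frame]); fields are framed by name, so aliasing is an
    issue only within one field. A ghost function [V] assigns a value to each node address, and
    every stored weight is a count of data, so that list surgery becomes a statement about
    successors in a set of reals. The least deviation of a block is never introduced as a minimum.
    The cost in [best] is attained at a datum, which is why a search among the data of a block
    recovers it, and it is compared with every level [y], which is what bounds a competitor whose
    levels are not data. Most time constants are generous round numbers. *)

Lemma onth_some (T : Type) (d : T) (t : seq T) k :
  k < size t -> onth t k = Some (nth d t k).
Proof. by elim: t k => //= y t IH [|k] //= /IH. Qed.

(** * Syntactic footprint and cost of commands *)

Fixpoint writes_var (c : cmd) (x : var) : bool :=
  match c with
  | Assign (Var y) _ | New y => x == y
  | Seq c1 c2 | If _ c1 c2 => writes_var c1 x || writes_var c2 x
  | While _ c1 => writes_var c1 x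
  | _ => false
  end.

(** [Alloc] counts as no write at all, so this footprint is sound only together with [no_alloc]; the
    program allocates all its arrays before doing anything else. *)
Fixpoint writes_arr (c : cmd) (a : arr) : bool :=
  match c with
  | Assign (Read b _) _ => a == b
  | Seq c1 c2 | If _ c1 c2 => writes_arr c1 a || writes_arr c2 a
  | While _ c1 => writes_arr c1 a
  | _ => false
  end.

Fixpoint writes_field (c : cmd) (fd : field) : bool :=
  match c with
  | Assign (Get _ fd') _ => fd == fd'
  | Seq c1 c2 | If _ c1 c2 => writes_field c1 fd || writes_field c2 fd
  | While _ c1 => writes_field c1 fd
  | _ => false
  end.

Fixpoint no_new (c : cmd) : bool :=
  match c with
  | New _ => false
  | Seq c1 c2 | If _ c1 c2 => no_new c1 && no_new c2
  | While _ c1 => no_new c1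
  | _ => true
  end.

Fixpoint no_alloc (c : cmd) : bool :=
  match c with
  | Alloc _ _ => false
  | Seq c1 c2 | If _ c1 c2 => no_alloc c1 && no_alloc c2
  | While _ c1 => no_alloc c1
  | _ => true
  end.

(** The value 0 for loops and allocations is a dummy: the bound is applied where [straight]
    succeeds, hence where the execution meets neither. *)
Fixpoint cost_bound (c : cmd) : nat :=
  match c with
  | Skip => 0
  | Assign e1 e2 => (ecost e1 + ecost e2).+1
  | New _ => (size fields).+1
  | Seq c1 c2 => cost_bound c1 + cost_bound c2
  | If b c1 c2 => (bcost b + maxn (cost_bound c1) (cost_bound c2)).+1
  | _ => 0
  end.

(** * Logic of timed executions *)

Section Logic.
Variable R : realDomainType.
Implicit Types (s : store R) (c : cmd) (b : bexpr) (e : expr) (v : val R).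
Implicit Types (x y : var) (Q : store R -> Prop).

Definition fld s k fd : val R := nth (blank_node R) (heap s) k fd.
Definition cel s a k : val R := nth (Ptr None) (arrays s a) k.

Definition set_fld s k fd v :=
  set_heap s (set_nth (blank_node R) (heap s) k
                      (upd (nth (blank_node R) (heap s) k) fd v)).
Definition set_cel s a k v := set_arr s a (set_nth v (arrays s a) k v).
Definition new_node s x :=
  set_heap (set_var s x (Ptr (Some (size (heap s)))))
           (rcons (heap s) (blank_node R)).

Lemma fld_set_fld s k fd v j fd' :
  fld (set_fld s k fd v) j fd' =
  if (j == k) && (fd' == fd) then v else fld s j fd'.
Proof. by rewrite /fld /= nth_set_nth /=; case: eqP => [->|]. Qed.

Lemma size_set_fld s k fd v :
  k < size (heap s) -> size (heap (set_fld s k fd v)) = size (heap s).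
Proof. by move=> hk; rewrite /= size_set_nth; apply/maxn_idPr. Qed.

Lemma cel_set_cel s a k v a' j : k < size (arrays s a) ->
  cel (set_cel s a k v) a' j =
  if (a' == a) && (j == k) then v else cel s a' j.
Proof.
move=> hk; rewrite /cel /=; case: eqP => [->|] //=.
elim: (arrays s a) k hk j => //= y t IH [|k] hk [|j] //=.
exact: IH.
Qed.

Lemma size_set_cel s a k v a' : k < size (arrays s a) ->
  size (arrays (set_cel s a k v) a') = size (arrays s a').
Proof.
move=> hk; rewrite /=; case: eqP => [->|] //.
by rewrite size_set_nth; apply/maxn_idPr.
Qed.

Lemma fld_new_node s x j fd : j < size (heap s) ->
  fld (new_node s x) j fd = fld s j fd.
Proof. by move=> hj; rewrite /fld /= nth_rcons hj. Qed.

Lemma fld_set_var s x v j fd : fld (set_var s x v) j fd = fld s j fd.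
Proof. by []. Qed.

Lemma fld_set_cel s a k v j fd : fld (set_cel s a k v) j fd = fld s j fd.
Proof. by []. Qed.

Lemma cel_set_var s x v a j : cel (set_var s x v) a j = cel s a j.
Proof. by []. Qed.

Lemma cel_set_fld s k fd v a j : cel (set_fld s k fd v) a j = cel s a j.
Proof. by []. Qed.

Lemma cel_new_node s x a j : cel (new_node s x) a j = cel s a j.
Proof. by []. Qed.

Lemma env_set_fld s k fd v : env (set_fld s k fd v) = env s.
Proof. by []. Qed.

Lemma env_set_cel s a k v : env (set_cel s a k v) = env s.
Proof. by []. Qed.

Lemma env_new_node s x :
  env (new_node s x) = upd (env s) x (Ptr (Some (size (heap s)))).
Proof. by []. Qed.

Lemma heap_set_cel s a k v : heap (set_cel s a k v) = heap s.
Proof. by []. Qed.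

Lemma size_new_node s x : size (heap (new_node s x)) = (size (heap s)).+1.
Proof. by rewrite /= size_rcons. Qed.

Lemma arrays_set_fld s k fd v : arrays (set_fld s k fd v) = arrays s.
Proof. by []. Qed.

Lemma arrays_new_node s x : arrays (new_node s x) = arrays s.
Proof. by []. Qed.

Lemma evalVar s x : eval s (Var x) = Some (env s x). Proof. by []. Qed.
Lemma evalNum s k : eval s (Num k) = Some (Idx k). Proof. by []. Qed.
Lemma evalZero s : eval s Zero = Some (Real 0%R). Proof. by []. Qed.
Lemma evalInfty s : eval s Infty = Some Infinity. Proof. by []. Qed.
Lemma evalNull s : eval s Null = Some (Ptr None). Proof. by []. Qed.
Lemma evalAdd s e1 e2 :
  eval s (Add e1 e2) = bind2 (@val_add R) (eval s e1) (eval s e2).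
Proof. by []. Qed.
Lemma evalSub s e1 e2 :
  eval s (Sub e1 e2) = bind2 (@val_sub R) (eval s e1) (eval s e2).
Proof. by []. Qed.
Lemma evalMul s e1 e2 :
  eval s (Mul e1 e2) = bind2 (@val_mul R) (eval s e1) (eval s e2).
Proof. by []. Qed.
Lemma evalAbs s e : eval s (Abs e) = obind (@val_abs R) (eval s e).
Proof. by []. Qed.
Lemma evalRead s a e :
  eval s (Read a e) =
  if eval s e is Some (Idx k)
  then if k < size (arrays s a) then Some (cel s a k) else None else None.
Proof.
rewrite /=; case: eval => // -[] // k.
by case: ltnP => h; [apply: onth_some|rewrite onth_default].
Qed.
Lemma evalGet s e fd :
  eval s (Get e fd) =
  if eval s e is Some (Ptr (Some k))
  then if k < size (heap s) then Some (fld s k fd) else None else None.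
Proof.
rewrite /=; case: eval => // -[] // [k|//].
by case: ltnP => h; [rewrite (onth_some (blank_node R))|rewrite onth_default].
Qed.
Definition evalE := (evalVar, evalNum, evalZero, evalInfty, evalNull, evalAdd,
  evalSub, evalMul, evalAbs, evalRead, evalGet).

Lemma assignVar s x v : assign s (Var x) v = Some (set_var s x v).
Proof. by []. Qed.
Lemma assignRead s a e v :
  assign s (Read a e) v =
  if eval s e is Some (Idx k)
  then if k < size (arrays s a) then Some (set_cel s a k v) else None else None.
Proof. by []. Qed.
Lemma assignGet s e fd v :
  assign s (Get e fd) v =
  if eval s e is Some (Ptr (Some k))
  then if k < size (heap s) then Some (set_fld s k fd v) else None else None.
Proof.
rewrite /=; case: eval => // -[] // [k|//].
by case: ltnP => h; [rewrite (onth_some (blank_node R))|rewrite onth_default].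
Qed.
Definition assignE := (assignVar, assignRead, assignGet).

Definition sizeE := (size_set_fld, size_set_cel, heap_set_cel, size_new_node,
  arrays_set_fld, arrays_new_node).
Definition fldE := (fld_set_var, fld_set_cel, fld_set_fld).

(** Framing fields by name, for the nodes existing beforehand, takes the place of separation of
    heaps, as the permanent and the temporary list use different fields. Constant array sizes and
    nodes that are never freed make the space monotone. *)
Record frame c s s' : Prop := Frame {
  frame_var : forall x, ~~ writes_var c x -> env s' x = env s x;
  frame_arr : forall a, ~~ writes_arr c a -> arrays s' a = arrays s a;
  frame_size : forall a, size (arrays s' a) = size (arrays s a);
  frame_fld : forall fd k, ~~ writes_field c fd -> k < size (heap s) ->
     fld s' k fd = fld s k fd;
  frame_heap : size (heap s) <= size (heap s');
  frame_no_new : no_new c -> size (heap s') = size (heap s) }.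

Lemma frame_refl c s : frame c s s.
Proof. by []. Qed.

Lemma frame_trans c s1 s2 s3 : frame c s1 s2 -> frame c s2 s3 -> frame c s1 s3.
Proof.
case=> v1 a1 z1 f1 h1 n1 [v2 a2 z2 f2 h2 n2]; split.
- by move=> x hx; rewrite v2 ?v1.
- by move=> a ha; rewrite a2 ?a1.
- by move=> a; rewrite z2.
- by move=> fd k hfd hk; rewrite f2 ?f1 //; apply: leq_trans h1.
- exact: leq_trans h2.
- by move=> hc; rewrite n2 ?n1.
Qed.

Lemma frame_weaken c c' s s' :
  (forall x, ~~ writes_var c' x -> ~~ writes_var c x) ->
  (forall a, ~~ writes_arr c' a -> ~~ writes_arr c a) ->
  (forall fd, ~~ writes_field c' fd -> ~~ writes_field c fd) ->
  (no_new c' -> no_new c) -> frame c s s' -> frame c' s s'.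
Proof.
move=> hv ha hf hn [v a z f h n].
by split=> //; auto => fd k hfd; apply: f; auto.
Qed.

Lemma frame_seq c1 c2 s1 s2 s3 :
  frame c1 s1 s2 -> frame c2 s2 s3 -> frame (Seq c1 c2) s1 s3.
Proof.
move=> f1 f2; apply: (@frame_trans _ _ s2).
  apply: frame_weaken f1 => [x|a|fd|] /=;
  by rewrite ?negb_or => /andP[].
apply: frame_weaken f2 => [x|a|fd|] /=;
by rewrite ?negb_or => /andP[].
Qed.

Lemma frame_while b c s s' : frame c s s' -> frame (While b c) s s'.
Proof. exact: frame_weaken. Qed.

Lemma frame_assign s s' e1 e2 v :
  assign s e1 v = Some s' -> frame (Assign e1 e2) s s'.
Proof.
case: e1 => //= [x [<-]|a e|e fd].
- by split=> //= y; case: eqP.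
- case: eval => // [[]] // k; case: ifP => // hk [<-].
  rewrite -/(set_cel s a k v); split=> //.
    by move=> b; rewrite /=; case: eqP.
  by move=> b; rewrite size_set_cel.
- case: eval => // [[]] // [k|//]; case E: onth => [nd|//] [<-].
  have hk : k < size (heap s).
    by rewrite -onthTE E.
  move: E => /(onth_nth (blank_node R)) <-.
  rewrite -/(set_fld s k fd v).
  split=> //; rewrite ?size_set_fld // => fd' j /= /negPf hfd hj.
  by rewrite fld_set_fld hfd andbF.
Qed.

Lemma exec_frame c s s' t m : no_alloc c -> exec c s s' t m -> frame c s s'.
Proof.
move=> hc E; elim: E hc => {c s s' t m}.
- by move=> s _; exact: frame_refl.
- by move=> s s' e1 e2 v _ /frame_assign.
- move=> s s' x -> _; rewrite -/(new_node s x); split=> //=.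
  + by move=> y; case: eqP.
  + by move=> fd k _ hk; rewrite fld_new_node.
  + by rewrite size_rcons.
- by [].
- move=> c1 c2 s s1 s2 t1 t2 m1 m2 _ IH1 _ IH2 /=/andP[/IH1 f1 /IH2 f2].
  exact: frame_seq f1 f2.
- move=> b c1 c2 s s' t m [] _ _ IH /=/andP[h1 h2];
  [move: (IH h1)|move: (IH h2)];
  apply: frame_weaken => [x|a|fd|] /=;
  by rewrite ?negb_or => /andP[].
- by move=> b c s _ _; exact: frame_refl.
- move=> b c s s1 s2 t1 t2 m1 m2 _ _ IH1 _ IH2 /= hc.
  exact: frame_trans (frame_while b (IH1 hc)) (IH2 hc).
Qed.

Lemma frame_space c s s' : frame c s s' -> space s <= space s'.
Proof.
move=> fr; rewrite /space !leq_add ?leq_mul ?(frame_heap fr) //.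
by rewrite (eq_bigr _ (fun a _ => esym (frame_size fr a))).
Qed.

Lemma exec_mem c s s' t m : no_alloc c -> exec c s s' t m -> m <= space s'.
Proof.
move=> hc E; move: (hc); elim: E hc => {c s s' t m} //.
- move=> s s' e1 e2 v ev /frame_assign-/(_ e2)/frame_space h _ _.
  by rewrite geq_max h leqnn.
- move=> s s' x hs _ _; rewrite geq_max leqnn andbT.
  by apply: (@frame_space (New x)); apply: exec_frame (ExecNew hs).
- move=> c1 c2 s s1 s2 t1 t2 m1 m2 E1 IH1 E2 IH2 /=/andP[h1 h2] _.
  rewrite geq_max IH2 // andbT (leq_trans (IH1 _ _)) //.
  exact: frame_space (exec_frame h2 E2).
- by move=> b c1 c2 s s' t m [] _ _ IH /=/andP[h1 h2] _; apply: IH.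
- move=> b c s s1 s2 t1 t2 m1 m2 _ E1 IH1 E2 IH2 h _.
  rewrite geq_max IH2 // andbT (leq_trans (IH1 _ _)) //.
  exact: frame_space (exec_frame h E2).
Qed.

(* Memory needs no tracking here: without [Alloc] the space in use never
   decreases, so that its maximum is the final one ([exec_mem]). *)
Definition runs c s (T : nat) Q : Prop :=
  exists s' t m, [/\ exec c s s' t m, t <= T & Q s'].

Lemma runs_weaken c s T T' Q Q' : runs c s T Q -> T <= T' ->
  (forall s', Q s' -> Q' s') -> runs c s T' Q'.
Proof.
move=> [s' [t [m [E ht hQ]]]] hT hQ'; exists s', t, m; split=> //; auto.
exact: leq_trans hT.
Qed.

Lemma runs_frame c s T Q : no_alloc c -> runs c s T Q ->
  runs c s T (fun s' => Q s' /\ frame c s s').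
Proof.
move=> hc [s' [t [m [E ht hQ]]]]; exists s', t, m; split=> //; split=> //.
exact: exec_frame E.
Qed.

Lemma runs_seq c1 c2 s T1 T2 T Q1 Q : no_alloc c1 ->
  runs c1 s T1 Q1 ->
  (forall s1, frame c1 s s1 -> Q1 s1 -> runs c2 s1 T2 Q) ->
  T1 + T2 <= T -> runs (Seq c1 c2) s T Q.
Proof.
move=> hc [s1 [t1 [m1 [E1 ht1 hQ1]]]] H hT.
have [s2 [t2 [m2 [E2 ht2 hQ]]]] := H s1 (exec_frame hc E1) hQ1.
exists s2, (t1 + t2), (maxn m1 m2); split=> //; first exact: ExecSeq E1 E2.
exact: leq_trans (leq_add ht1 ht2) hT.
Qed.

Lemma runs_if b c1 c2 s T T' Q (q : bool) : test s b = Some q ->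
  runs (if q then c1 else c2) s T Q -> (bcost b + T).+1 <= T' ->
  runs (If b c1 c2) s T' Q.
Proof.
move=> hq [s' [t [m [E ht hQ]]]] hT; exists s', (bcost b + t).+1, m.
split=> //; first exact: ExecIf E.
by apply: leq_trans hT; rewrite ltnS leq_add2l.
Qed.

(* The variant [k] also pays for time: an iteration may take [B] units of time
   for each unit by which it decreases [k]. *)
Lemma runs_while_amortized b c s0 (I : nat -> store R -> Prop) B k0 T Q :
  no_alloc c -> I k0 s0 ->
  (forall k s, I k s -> frame c s0 s -> exists q, test s b = Some q /\
     if q then exists B', runs c s B' (fun s' =>
       exists k', [/\ k' < k, B' <= B * (k - k') & I k' s'])
     else Q s) ->
  k0 * (bcost b + B).+1 + (bcost b).+1 <= T ->
  runs (While b c) s0 T Q.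
Proof.
move=> hc I0 H hT; move: I0 (frame_refl c s0) hT.
elim/ltn_ind: k0 {-2}s0 T => k IH s T hI fr hT.
have [[] [hb]] := H _ _ hI fr; last first.
  move=> hQ; exists s, (bcost b).+1, (space s); split=> //.
    exact: ExecWhileFalse.
  exact: leq_trans (leq_addl _ _) hT.
move=> [B' [s1 [t1 [m1 [E1 ht1 [k' [ltk hB' hI']]]]]]].
have [] := IH _ ltk s1 (k' * (bcost b + B).+1 + (bcost b).+1) hI' => //.
  exact: frame_trans (exec_frame hc E1).
move=> s2 [t2 [m2 [E2 ht2 hQ]]].
exists s2, (bcost b + t1 + t2).+1, (maxn m1 m2); split=> //.
  exact: ExecWhileTrue E1 E2.
(* An iteration that lowers the variant by [k - k'] owns that many shares of the budget: one
   suffices for the test, all of them pay for the body. *)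
apply: leq_trans hT; apply: leq_trans (_ : _ <= (k - k') * (bcost b + B).+1 +
    (k' * (bcost b + B).+1 + (bcost b).+1)) _; last first.
  by rewrite addnA -mulnDl subnK // ltnW.
have h1 : (bcost b).+1 <= (k - k') * (bcost b).+1 by rewrite leq_pmull //
  subn_gt0.
have h2 : (k - k') * (bcost b + B).+1 = (k - k') * (bcost b).+1 + B * (k - k').
  by rewrite -addSn mulnDr (mulnC B).
by lia.
Qed.

Lemma runs_while b c s0 (I : nat -> store R -> Prop) B k0 T Q : no_alloc c ->
  I k0 s0 ->
  (forall k s, I k s -> frame c s0 s -> exists q, test s b = Some q /\
     if q then runs c s B (fun s' => exists2 k', k' < k & I k' s') else Q s) ->
  k0 * (bcost b + B).+1 + (bcost b).+1 <= T ->
  runs (While b c) s0 T Q.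
Proof.
move=> hc I0 H; apply: runs_while_amortized I0 _ => // k s hI fr.
have [[] [hb hr]] := H k s hI fr; last by exists false.
exists true; split=> //; exists B; apply: runs_weaken hr (leqnn _) _.
move=> s' [k' ltk hI']; exists k'; split=> //.
by rewrite leq_pmulr // subn_gt0.
Qed.

(** A symbolic executor: the correctness of loop-free code becomes one equation, provable by
    rewriting. Only the branch actually taken is followed. *)
Fixpoint straight s c : option (store R) :=
  match c with
  | Skip => Some s
  | Assign e1 e2 => if eval s e2 is Some v then assign s e1 v else None
  | New x => Some (new_node s x)
  | Seq c1 c2 => if straight s c1 is Some s1 then straight s1 c2 else None
  | If b c1 c2 =>
      if test s b is Some q then straight s (if q then c1 else c2) else None
  | Alloc _ _ | While _ _ => None
  end.

Lemma runs_straight c s s' T Q :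
  straight s c = Some s' -> Q s' -> cost_bound c <= T -> runs c s T Q.
Proof.
move=> hs hQ hT; suff: exists t m, exec c s s' t m /\ t <= cost_bound c.
  move=> [t [m [E ht]]]; exists s', t, m; split=> //; exact: leq_trans hT.
elim: c s s' hs {hQ hT} => //=.
- by move=> s s' [<-]; exists 0, (space s); split=> //; exact: ExecSkip.
- move=> e1 e2 s s'; case E: eval => [v|//] hs.
  by exists (ecost e1 + ecost e2).+1, (maxn (space s) (space s')); split=> //;
     apply: ExecAssign E hs.
- move=> x s s' [<-].
  by exists (size fields).+1, (maxn (space s) (space (new_node s x)));
    split=> //; exact: ExecNew.
- move=> c1 IH1 c2 IH2 s s'; case E: straight => [s1|//] hs.
  have [t1 [m1 [E1 h1]]] := IH1 _ _ E; have [t2 [m2 [E2 h2]]] := IH2 _ _ hs.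
  by exists (t1 + t2), (maxn m1 m2); split;
    [exact: ExecSeq E1 E2|exact: leq_add].
- move=> b c1 IH1 c2 IH2 s s'; case E: test => [q|//] hs.
  have [t [m [E1 ht]]] : exists t m, exec (if q then c1 else c2) s s' t m /\
      t <= maxn (cost_bound c1) (cost_bound c2).
    case: q {E} hs => [/IH1|/IH2] [t [m [E ht]]]; exists t, m; split=> //.
      by rewrite leq_max ht.
    by rewrite leq_max ht orbT.
  exists (bcost b + t).+1, m; split; first exact: ExecIf E E1.
  by rewrite ltnS leq_add2l.
Qed.

Lemma runs_step c1 c2 s s1 T Q : no_alloc c1 -> straight s c1 = Some s1 ->
  (frame c1 s s1 -> runs c2 s1 (T - cost_bound c1) Q) -> cost_bound c1 <= T ->
  runs (Seq c1 c2) s T Q.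
Proof.
move=> h1 hs H hT; have hr : runs c1 s (cost_bound c1) (eq s1).
  exact: runs_straight hs _ _.
apply: (runs_seq (T2 := T - cost_bound c1) h1 hr) => [s2 fr es|];
  last by rewrite subnKC.
by rewrite -es in fr *; exact: H.
Qed.

(** The invariant at [k] describes the store in which the counter already equals [k]; [lo <= hi.+1]
    admits an empty range. A round adds 9 to the body, 4 for the test and 5 for the increment; the
    initial assignment costs [ecost a + 2] and the final test 4. *)
Lemma runs_for x y a c s0 lo hi (I : nat -> store R -> Prop) B T Q :
  no_alloc c -> ~~ writes_var c x -> ~~ writes_var c y -> y != x ->
  eval s0 a = Some (Idx lo) -> env s0 y = Idx hi -> lo <= hi.+1 ->
  I lo (set_var s0 x (Idx lo)) ->
  (forall k s, lo <= k -> k <= hi -> I k s -> env s x = Idx k -> env s y = Idx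
    hi ->
     frame (For x a y c) s0 s ->
     runs c s B (fun s' => I k.+1 (set_var s' x (Idx k.+1)))) ->
  (forall s, I hi.+1 s -> frame (For x a y c) s0 s -> Q s) ->
  (hi.+1 - lo) * (B + 9) + (ecost a + 6) <= T ->
  runs (For x a y c) s0 T Q.
Proof.
move=> hc hx hy hyx ha hhi hlo I0 H HQ hT.
set s1 := set_var s0 x (Idx lo).
have fr1 : frame (Assign x a) s0 s1 by apply: frame_assign.
apply: (@runs_seq _ _ _ (ecost a + 2) ((hi.+1 - lo) * (B + 9) + 4) _
         (fun s => s = s1)) => //.
- by apply: (@runs_straight _ _ s1) => /=; rewrite ?ha //; lia.
- move=> _ _ ->.
  pose J k s := exists i, [/\ k = hi.+1 - i, lo <= i <= hi.+1,
     env s x = Idx i, env s y = Idx hi & I i s].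
  apply: (@runs_while _ _ _ J (B + 5) (hi.+1 - lo)) => /=.
  + by rewrite hc.
  + by exists lo; split=> //=; rewrite ?leqnn ?hlo ?eqxx ?(negPf hyx).
  + move=> k s [i [-> /andP[lei lei'] ex ey hI]] fr; rewrite ex ey /=.
    exists (i <= hi); split=> //.
    have fr' := frame_seq fr1 (frame_while (x <= y) fr).
    case: leqP => [lei2|lti]; last first.
      have ? : i = hi.+1 by lia.
      by subst i; apply: HQ.
    apply: (@runs_seq _ _ _ B 5) => //.
      by apply: (H i).
    move=> s2 fr2 hI2; apply: (@runs_straight _ _ (set_var s2 x (Idx i.+1))).
    * by rewrite /= (frame_var fr2 hx) ex /= addn1.
    * exists (hi - i); first by lia.
      exists i.+1; split=> //=;
        rewrite ?eqxx ?(negPf hyx) ?(frame_var fr2 hy) //.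
      by rewrite ltnS lei2 leqW.
    * by [].
  + by lia.
- by lia.
Qed.

End Logic.

(** * Tactics for symbolic execution *)

#[local] Arguments eval : simpl never.
#[local] Arguments assign : simpl never.
#[local] Arguments set_fld : simpl never.
#[local] Arguments set_cel : simpl never.
#[local] Arguments new_node : simpl never.
#[local] Opaque set_fld set_cel new_node.

(** The context serves as the known part of the store: equations for [env], [cel], [fld] and bounds
    on sizes act as rewriting rules. For this reason such facts are collected as hypotheses before
    each call. *)
Ltac simulate_step :=
  first
  [ progress rewrite ?(evalE, assignE, subn1, eqxx, andbF, andbT) /=
  | match goal with
    | |- context [env (set_fld _ _ _ _)] => rewrite env_set_fld
    | |- context [env (set_cel _ _ _ _)] => rewrite env_set_cel
    | |- context [env (new_node _ _)] => rewrite env_new_node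
    | |- context [arrays (set_fld _ _ _ _)] => rewrite arrays_set_fld
    | |- context [arrays (new_node _ _)] => rewrite arrays_new_node
    | |- context [heap (set_cel _ _ _ _)] => rewrite heap_set_cel
    | |- context [cel (set_var _ _ _) _ _] => rewrite cel_set_var
    | |- context [cel (set_fld _ _ _ _) _ _] => rewrite cel_set_fld
    | |- context [cel (new_node _ _) _ _] => rewrite cel_new_node
    | |- context [fld (set_var _ _ _) _ _] => rewrite fld_set_var
    | |- context [fld (set_cel _ _ _ _) _ _] => rewrite fld_set_cel
    | |- context [fld (set_fld _ _ _ _) _ _] => rewrite fld_set_fld
    | H : env ?s ?x = _ |- context [env ?s ?x] => rewrite H
    | H : cel ?s ?a ?k = _ |- context [cel ?s ?a ?k] => rewrite H
    | H : fld ?s ?a ?k = _ |- context [fld ?s ?a ?k] => rewrite H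
    | H : is_true (?k < size ?t) |- context [(?k < size ?t)] => rewrite H
    | H : is_true (?k < ?m) |- context [(?k < ?m.+1)] => rewrite (leqW H)
    | |- context [size (heap (new_node _ _))] => rewrite size_new_node
    | |- context [size (heap (set_fld _ _ _ _))] => rewrite size_set_fld
    | |- context [size (arrays (set_cel _ _ _ _) _)] => rewrite size_set_cel
    end
  | rewrite ltnSn ].

Ltac simulate := rewrite /=; repeat simulate_step; try done.

(** * Counting and deviations *)

Section Data.
Local Open Scope ring_scope.
Variable R : realDomainType.
Implicit Types (x : nat -> R) (l r : nat) (y z : R) (P : pred R).

(** Ranges are half-open and 0-based: [l <= j < r] is the block of data of index l+1, ..., r. As
    weights are 1, a count is a weight. *)
Definition num x l r P : nat := (\sum_(l <= j < r) P (x j))%N.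
Definition dev x l r y : R := \sum_(l <= j < r) `|x j - y|.
Definition partial_sum x l r P (g : R -> R) : R :=
  \sum_(l <= j < r | P (x j)) g (x j).

Lemma eq_num x l r P P' :
  (forall j, (l <= j < r)%N -> P (x j) = P' (x j)) ->
  num x l r P = num x l r P'.
Proof. by move=> h; apply: eq_big_nat => j /h ->. Qed.

Lemma num_ltn x l r P : (l < r)%N ->
  num x l r P = (P (x l) + num x l.+1 r P)%N.
Proof. by move=> h; rewrite /num big_ltn. Qed.

Lemma num_recr x l r P : (l <= r)%N ->
  num x l r.+1 P = (num x l r P + P (x r))%N.
Proof. by move=> h; rewrite /num big_nat_recr. Qed.

Lemma num_gt0P x l r P :
  reflect (exists2 j, (l <= j < r)%N & P (x j)) (0 < num x l r P)%N.
Proof.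
rewrite lt0n /num sum_nat_seq_eq0 -has_predC.
apply: (iffP hasP) => [[j]|[j hj Pj]].
  by rewrite mem_index_iota /= => hj; rewrite eqb0 negbK => Pj; exists j.
by exists j; rewrite ?mem_index_iota //= eqb0 negbK.
Qed.

Lemma num_le x l r P : (num x l r P <= r - l)%N.
Proof.
rewrite /num -[leqRHS]mul1n -[leqRHS]mulnC -sum_nat_const_nat.
by apply: leq_sum => j _; case: (P _).
Qed.

Lemma num_addU x l r P P1 P2 :
  (forall y, (P y : nat) = (P1 y + P2 y)%N) ->
  num x l r P = (num x l r P1 + num x l r P2)%N.
Proof. by move=> h; rewrite /num -big_split; apply: eq_bigr => j _;
  rewrite h. Qed.

Lemma num_le_lt x l r y :
  num x l r (<= y) = (num x l r (< y) + num x l r (pred1 y))%N.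
Proof. by apply: num_addU => z /=; case: ltgtP. Qed.

Lemma num_ge_gt x l r y :
  num x l r (>= y) = (num x l r (> y) + num x l r (pred1 y))%N.
Proof. by apply: num_addU => z /=; case: ltgtP. Qed.

Lemma num_predC x l r P : (num x l r P + num x l r (predC P) = r - l)%N.
Proof.
rewrite -(@num_addU _ _ _ predT) => [|y /=]; last by case: (P y).
by rewrite /num sum_nat_const_nat muln1.
Qed.

Lemma num_oppr x l r y : num (fun j => - x j) l r (< - y) = num x l r (> y).
Proof. by apply: eq_bigr => j _ /=; rewrite ltrN2. Qed.

Lemma num_opp_eq x l r y :
  num (fun j => - x j) l r (pred1 (- y)) = num x l r (pred1 y).
Proof. by apply: eq_bigr => j _ /=; rewrite eqr_opp. Qed.

Lemma num_oppl x l r y : num (fun j => - x j) l r (> - y) = num x l r (< y).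
Proof. by apply: eq_bigr => j _ /=; rewrite ltrN2. Qed.

Lemma dev_opp x l r y : dev (fun j => - x j) l r (- y) = dev x l r y.
Proof. by apply: eq_bigr => j _; rewrite -opprD normrN. Qed.

Lemma dev_ltn x l r y : (l < r)%N -> dev x l r y = `|x l - y| + dev x l.+1 r y.
Proof. by move=> h; rewrite /dev big_ltn. Qed.

Lemma dev_recr x l r y : (l <= r)%N -> dev x l r.+1 y = dev x l r y + `|x r -
  y|.
Proof. by move=> h; rewrite /dev big_nat_recr. Qed.

Lemma dev_empty x l y : dev x l l y = 0.
Proof. by rewrite /dev big_geq. Qed.

Lemma natr_num x l r P : (num x l r P)%:R = \sum_(l <= j < r) (P (x j))%:R :> R.
Proof. by rewrite /num natr_sum. Qed.

(** No datum lies strictly between [y] and [z], so the deviation is affine there, with slope the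
    number of data at most [y] minus the number above. This is the update of [dist_] in a shift. *)
Lemma dev_shift x l r y z : y < z ->
  (forall j, (l <= j < r)%N -> y < x j -> z <= x j) ->
  dev x l r z = dev x l r y
    + ((num x l r (< y))%:R + (num x l r (pred1 y))%:R - (num x l r (> y))%:R)
      * (z - y).
Proof.
move=> yz h; rewrite -natrD -num_le_lt !natr_num -sumrB mulr_suml -big_split.
apply: eq_big_nat => j /h /=; case: ltP => hj /=.
move=> /(_ isT) hz; rewrite !ger0_norm ?subr_ge0 // ?(ltW hj) //; ring.
move=> _; rewrite !ler0_norm ?subr_le0 //; last exact: le_trans (ltW yz).
by ring.
Qed.

(** The slope to the right of [y] is nonnegative by hypothesis, and a convex function lies above its
    tangent; the latter is checked term by term. *)
Lemma dev_median_le x l r y z :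
  (num x l r (> y) <= num x l r (< y) + num x l r (pred1 y))%N ->
  y <= z -> dev x l r y <= dev x l r z.
Proof.
move=> h yz; apply: (@le_trans _ _ (dev x l r y
    + ((num x l r (<= y))%:R - (num x l r (> y))%:R) * (z - y))).
  by rewrite lerDl mulr_ge0 ?subr_ge0 // num_le_lt ler_nat.
rewrite !natr_num -sumrB mulr_suml -big_split.
apply: ler_sum => j _ /=; case: (ltP y (x j)) => hj /=.
  have -> : `|x j - y| = x j - y by rewrite ger0_norm // subr_ge0 ltW.
  by have := ler_norm (x j - z); lra.
rewrite (ler0_norm (_ : x j - y <= 0)) ?subr_le0 //.
by have := ler_norm (- (x j - z)); rewrite normrN; lra.
Qed.

Lemma dev_median x l r y z :
  (num x l r (> y) <= num x l r (< y) + num x l r (pred1 y))%N ->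
  (num x l r (< y) <= num x l r (> y) + num x l r (pred1 y))%N ->
  dev x l r y <= dev x l r z.
Proof.
move=> h1 h2; case: (leP y z) => [|/ltW] yz; first exact: dev_median_le.
rewrite -[dev x l r y]dev_opp -[dev x l r z]dev_opp dev_median_le ?lerN2 //.
by rewrite num_oppr num_oppl num_opp_eq.
Qed.

Lemma partial_sum_lt_le x l r y g :
  partial_sum x l r (<= y) g =
  partial_sum x l r (< y) g + (num x l r (pred1 y))%:R * g y.
Proof.
rewrite natr_num mulr_suml /partial_sum big_mkcond [in RHS]big_mkcond
  -big_split.
apply: eq_bigr => j _ /=; case: ltgtP => [||->];
by rewrite ?mul0r ?mul1r ?addr0 ?add0r.
Qed.

Lemma eq_partial_sum x l r P P' g :
  (forall j, (l <= j < r)%N -> P (x j) = P' (x j)) ->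
  partial_sum x l r P g = partial_sum x l r P' g.
Proof.
move=> h; rewrite /partial_sum big_mkcond [RHS]big_mkcond.
by apply: eq_big_nat => j /h ->.
Qed.

(** * Successors in a set of values *)

Implicit Types (A : pred nat) (V : nat -> R) (o : option nat).

(** [k] itself need not lie in [A], which covers both a node yet to be inserted and a node just
    removed. *)
Definition nxt A V k o : Prop :=
  if o is Some q then
    [/\ A q, V k < V q & forall i, A i -> V k < V i -> V q <= V i]
  else forall i, A i -> V i <= V k.

(* Stated through [nxt], so that each fact about one side of the list yields the
   fact about the other side by negating the values. *)
Definition prv A V := nxt A (fun k => - V k).

Definition covers x l r A V :=
  forall j, (l <= j < r)%N -> exists2 k, A k & V k = x j.

(** The values that a traversal with cursor [o] has passed; at the null pointer these are all
    values. *)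
Definition before V o : pred R :=
  fun y => if o is Some q then y < V q else true.

Lemma covers_opp x l r A V :
  covers x l r A V -> covers (fun j => - x j) l r A (fun k => - V k).
Proof. by move=> h j /h[k Ak <-]; exists k. Qed.

(** Every datum has a node, and no node lies strictly between [k] and its successor. The incremental
    updates of counts, sums and deviations all rest on this. *)
Lemma before_nxt x l r A V k o j : covers x l r A V -> nxt A V k o ->
  (l <= j < r)%N -> before V o (x j) = (x j <= V k).
Proof.
move=> cov + hj; have [i Ai <-] := cov j hj; case: o => [q|] /=; last by move->.
case=> Aq kq least; case: (leP (V i) (V k)) => [h|h].
  exact: le_lt_trans kq.
by apply/negbTE; rewrite -leNgt least.
Qed.

Lemma nxt_none x l r A V k :
  covers x l r A V -> (0 < num x l r (> V k))%N -> ~ nxt A V k None.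
Proof.
move=> cov /num_gt0P[j hj /= hk] h; have /= := before_nxt (o := None) cov h hj.
by rewrite leNgt hk.
Qed.

Lemma num_lt_nxt x l r A V k q : covers x l r A V -> nxt A V k (Some q) ->
  num x l r (< V q) = (num x l r (< V k) + num x l r (pred1 (V k)))%N.
Proof.
move=> cov h; rewrite -num_le_lt; apply: eq_num => j hj.
exact: before_nxt cov h hj.
Qed.

Lemma num_gt_nxt x l r A V k q : covers x l r A V -> nxt A V k (Some q) ->
  num x l r (> V k) = (num x l r (> V q) + num x l r (pred1 (V q)))%N.
Proof.
move=> cov h; rewrite -num_ge_gt; apply: eq_num => j hj.
by have /= := before_nxt cov h hj=> e; rewrite (ltNge (V k)) -e -leNgt.
Qed.

Lemma dev_nxt x l r A V k q : covers x l r A V -> nxt A V k (Some q) ->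
  dev x l r (V q) = dev x l r (V k)
    + ((num x l r (< V k))%:R + (num x l r (pred1 (V k)))%:R
       - (num x l r (> V k))%:R) * (V q - V k).
Proof.
move=> cov h; have [_ kq _] := h; apply: dev_shift => // j hj.
by move=> kj; have /= := before_nxt cov h hj;
  rewrite (leNgt (x j)) kj => /negbT; rewrite -leNgt.
Qed.

Lemma eq_nxt A A' V V' k o :
  (forall i, A i -> A' i) -> (forall i, A' i -> A i) -> V k = V' k ->
  (forall i, A i -> V i = V' i) -> nxt A V k o -> nxt A' V' k o.
Proof.
move=> h1 h2 ek eV; case: o => [q [Aq kq least]|least] /=.
  rewrite -ek -eV //; split=> //; first exact: h1.
  by move=> i A'i; rewrite -eV; auto.
by move=> i A'i; rewrite -ek -eV; auto.
Qed.

(* Only the node preceding the unlinked [p] changes its successor. *)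
Lemma nxt_remove A V p op oq k o :
  {in A &, injective V} -> A p -> A k ->
  prv A V p oq -> nxt A V p op -> nxt A V k o ->
  nxt (predD1 A p) V k (if oq == Some k then op else o).
Proof.
move=> injV Ap Ak; case: eqP => [-> [_ kp kmax] hop _|ne hoq hop].
  rewrite /= ltrN2 in kp.
  have below i : A i -> i != p -> V k < V i -> V p < V i.
    move=> Ai ip ki; rewrite lt_neqAle; apply/andP; split.
      by apply: contra_neq ip => /injV ->.
    rewrite leNgt; apply/negP => ip'; have := kmax i Ai.
    by rewrite /= ltrN2 lerN2 leNgt ki => /(_ ip').
  case: op hop => [q [Aq pq least]|least] /=.
    split.
      by apply/andP; split=> //=; apply: contraTneq pq => ->; rewrite ltxx.
      exact: lt_trans pq.
    by move=> i /andP[/= ip Ai] ki; apply: least => //; apply: below.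
  move=> i /andP[/= ip Ai]; rewrite leNgt; apply/negP => /(below i Ai ip).
  by rewrite ltNge least.
case: o => [q [Aq kq least]|least] /=; last by move=> i /andP[_ /least].
split=> //; last by move=> i /andP[_ Ai]; exact: least.
(* If [p] were the successor of [k], then [k] would be the predecessor of [p], against [ne]: the
   true predecessor would lie strictly between them. *)
apply/andP; split=> //=; apply/eqP => eqp; subst q.
case: oq ne hoq => [i|] ne /=; last first.
  by move/(_ k Ak); rewrite lerN2 leNgt kq.
rewrite ltrN2 => -[Ai ip imax].
have := imax k Ak; rewrite ltrN2 lerN2 kq => /(_ isT) ki.
have ki' : V k < V i.
  rewrite lt_neqAle ki andbT; apply/eqP => /injV ik.
  by apply: ne; rewrite ik.
by have := least i Ai ki'; rewrite leNgt ip.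
Qed.

(** Counterpart of the removal: a node [k] below the new [p] that is not its predecessor keeps its
    successor, because some element of [A] already lies strictly between [k] and [p]. *)
Lemma nxt_insert A V p op oq k o :
  {in A &, injective V} -> (forall i, A i -> V i != V p) -> A k ->
  prv A V p oq -> nxt A V p op -> nxt A V k o ->
  nxt (predU1 p A) V k (if oq == Some k then Some p else o).
Proof.
move=> injV neq Ak; case: eqP => [-> [_ + kmax] _ _|ne hoq hop].
  rewrite ltrN2 => kp; split=> //=; first by rewrite /= eqxx.
  move=> i /predU1P[->//|Ai] ki; rewrite leNgt; apply/negP => ip.
  by have := kmax i Ai; rewrite ltrN2 lerN2 leNgt ki => /(_ ip).
have below : V k < V p -> exists2 i, A i & V k < V i < V p.
  move=> kp; case: oq ne hoq => [i|] ne /=; last first.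
    by move/(_ k Ak); rewrite lerN2 leNgt kp.
  rewrite ltrN2 => -[Ai ip imax]; exists i; rewrite ?ip ?andbT //.
  have := imax k Ak; rewrite ltrN2 lerN2 kp => /(_ isT) ki.
  rewrite lt_neqAle ki andbT; apply/eqP => /injV ik.
  by apply: ne; rewrite ik.
case: o => [q [Aq kq least]|least] /=.
  split=> //; first by apply/orP; right.
  move=> i /predU1P[->|]; last exact: least.
  by move=> /below[a Aa /andP[ka /ltW ap]]; apply: le_trans ap; apply: least.
move=> i /predU1P[->|]; last exact: least.
rewrite leNgt; apply/negP => /below[a Aa /andP[ka _]].
by have := least a Aa; rewrite leNgt ka.
Qed.

Lemma nxt_insert_self A V p op : nxt A V p op -> nxt (predU1 p A) V p op.
Proof.
case: op => [q [Aq pq least]|least] /=.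
  split=> //; first by apply/orP; right.
  by move=> i /predU1P[->|]; [rewrite ltxx|exact: least].
by move=> i /predU1P[->|]; [rewrite lexx|exact: least].
Qed.

End Data.

(** * Sorted histograms *)

Section Histogram.
Local Open Scope ring_scope.
Variables (R : realDomainType) (n : nat) (x : nat -> R) (gamma : R).
Implicit Types (s : store R) (V : nat -> R) (A : pred nat) (o : option nat).

(** Holds from the end of the allocations on. The additional cell of [P_] is the one for P_0. *)
Record inputs s : Prop := Inputs {
  in_n : env s n_ = Idx n;
  in_gamma : env s gamma_ = Real gamma;
  in_size : forall a, size (arrays s a) = (n + (a == P_))%N;
  in_F : forall j, (j < n)%N -> cel s F_ j = Real (x j);
  in_W : forall j, (j < n)%N -> cel s W_ j = Real 1 }.

Lemma inputs_frame c s s' : frame c s s' ->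
  [&& ~~ writes_var c n_, ~~ writes_var c gamma_, ~~ writes_arr c F_
    & ~~ writes_arr c W_] -> inputs s -> inputs s'.
Proof.
move=> fr /and4P[cn cg cF cW] [hn hg hs hF hW]; split.
- by rewrite (frame_var fr).
- by rewrite (frame_var fr).
- by move=> a; rewrite (frame_size fr).
- by move=> j /hF; rewrite /cel (frame_arr fr).
- by move=> j /hW; rewrite /cel (frame_arr fr).
Qed.

Definition node s : pred nat := fun k => (k < size (heap s))%N.

(* [A'] is smaller than [A] after a removal: the removed node keeps the pointers
   to its former neighbours, from which a removed pivot is shifted away. *)
Definition linked s (fn fp : field) (A A' : pred nat) V : Prop :=
  forall k, A k -> (exists2 o, fld s k fn = Ptr o & nxt A' V k o) /\
                   (exists2 o, fld s k fp = Ptr o & prv A' V k o).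

Definition first (A : pred nat) V o : Prop :=
  if o is Some h then A h /\ (forall i, A i -> V h <= V i)
  else forall i, ~~ A i.

(** [hist_size] is the source of the linear space bound; [hist_pos], no node without a datum, bounds
    the length of a traversal by [r]. *)
Record hist V r s : Prop := Hist {
  hist_val : forall k, node s k -> fld s k value_ = Real (V k);
  hist_weight : forall k, node s k ->
    fld s k weight_ = Real (num x 0 r (pred1 (V k)))%:R;
  hist_inj : {in node s &, injective V};
  hist_size : (size (heap s) <= r)%N;
  hist_pos : forall k, node s k -> (0 < num x 0 r (pred1 (V k)))%N;
  hist_I : forall j, (j < r)%N ->
    exists k, [/\ node s k, V k = x j & cel s I_ j = Ptr (Some k)];
  hist_head : exists2 o, env s head_ = Ptr o & first (node s) V o;
  hist_linked : linked s next_ prev_ (node s) (node s) V }.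

Lemma hist_covers V r s l : hist V r s -> covers x l r (node s) V.
Proof. by move=> hs j /andP[_ /(hist_I hs)[k [hk <- _]]]; exists k. Qed.

Lemma linked_frame c s s' fn fp A A' V : frame c s s' ->
  ~~ writes_field c fn && ~~ writes_field c fp ->
  (forall k, A k -> node s k) -> linked s fn fp A A' V -> linked s' fn fp A A'
    V.
Proof.
move=> fr /andP[cn cp] hA h k Ak; have hk := hA k Ak.
by have := h k Ak; rewrite !(frame_fld fr).
Qed.

Lemma node_frame c s s' : frame c s s' -> no_new c -> node s' = node s.
Proof. by move=> fr hc; rewrite /node (frame_no_new fr hc). Qed.

Lemma hist_frame c V r s s' : frame c s s' -> no_new c ->
  [&& ~~ writes_var c head_, ~~ writes_arr c I_, ~~ writes_field c value_,
      ~~ writes_field c weight_, ~~ writes_field c next_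
    & ~~ writes_field c prev_] -> hist V r s -> hist V r s'.
Proof.
move=> fr nn /and5P[ch cI cv cw cnp] [hv hw hi hs hp hI hh hl].
have eN := node_frame fr nn.
split; rewrite ?eN //.
- by move=> k hk; rewrite (frame_fld fr) ?hv.
- by move=> k hk; rewrite (frame_fld fr) ?hw.
- by rewrite (frame_no_new fr nn).
- by move=> j /hI; rewrite /cel (frame_arr fr).
- by rewrite (frame_var fr).
- exact: linked_frame fr cnp _ hl.
Qed.

(** The data still ahead of the cursor serve as the variant of a traversal, in place of a length of
    the list; it drops because a node carries at least one datum. *)
Lemma before_decreases l r A V c o : covers x l r A V -> nxt A V c o ->
  (0 < num x l r (pred1 (V c)))%N ->
  (num x l r (predC (before V o)) < num x l r (predC (before V (Some c))))%N.
Proof.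
move=> cov h.
have e : num x l r (before V o) =
    (num x l r (before V (Some c)) + num x l r (pred1 (V c)))%N.
  by rewrite -num_le_lt; apply: eq_num => j; exact: before_nxt cov h.
have := num_predC x l r (before V o);
  have := num_predC x l r (before V (Some c)).
by lia.
Qed.

Lemma before_first l r A V o : covers x l r A V -> first A V o ->
  forall j, (l <= j < r)%N -> before V o (x j) = false.
Proof.
move=> cov + j hj; have [i Ai <-] := cov j hj.
case: o => [h [_ /(_ i Ai)]|/(_ i)] /=; last by rewrite Ai.
by rewrite leNgt => /negbTE.
Qed.

(* [p] and [c] are the neighbours of a node of value [y] yet to be linked in. *)
Definition gap A V y p c : Prop :=
  (if p is Some i then [/\ A i, V i < y & nxt A V i c] else first A V c) /\
  (if c is Some i then A i /\ y <= V i else True).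

Lemma gap_nxt A V y p c q : V q = y -> (forall i, A i -> V i != y) ->
  gap A V y p c -> nxt A V q c.
Proof.
move=> eq_y neq [hp hc]; case: c hp hc => [i|] hp.
  move=> [Ai yi]; split=> //; rewrite eq_y;
    first by rewrite lt_neqAle eq_sym neq.
  move=> j Aj yj; case: p hp => [p|[_]]; last exact.
  by case=> [Ap py [_ _]]; apply=> //; apply: lt_trans yj.
move=> _ j Aj; rewrite eq_y; case: p hp => [p [Ap py h]|/(_ j)].
  by rewrite (le_trans (h j Aj)) // ltW.
by rewrite Aj.
Qed.

Lemma gap_prv A V y p c q : V q = y -> gap A V y p c -> prv A V q p.
Proof.
move=> eq_y [hp hc]; case: p hp => [i|] /= hp; last first.
  move=> j Aj; rewrite lerN2 eq_y; case: c hp hc => [k [_ h] [_ yk]|/(_ j)].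
    by rewrite (le_trans yk) ?h.
  by rewrite Aj.
case: hp => Ai iy h; split=> //; first by rewrite ltrN2 eq_y.
move=> j Aj; rewrite ltrN2 lerN2 eq_y => jy; rewrite leNgt; apply/negP => ij.
case: c h hc => [k [_ _ least] [_ yk]|/(_ j Aj)]; last by rewrite leNgt ij.
by have := least j Aj ij; rewrite leNgt (lt_le_trans jy).
Qed.

Lemma eq_gap A V V' y p c : (forall i, A i -> V i = V' i) ->
  gap A V y p c -> gap A V' y p c.
Proof.
move=> e [hp hc]; split; last first.
  by case: c hc {hp} => // i [Ai yi]; rewrite -e.
case: p hp => [i [Ai iy h]|].
  by split; rewrite -?e //; apply: (eq_nxt _ _ _ _ h) => //; exact: e.
case: c {hc} => // i [Ai h]; split=> // j Aj; rewrite -!e //; exact: h.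
Qed.

Definition search_loop : cmd :=
  (While ((cur_ != Null) && (cur_~>value_ < F_.[r_ - 1%N])) (
    prv_ <~ cur_ ;;
    cur_ <~ cur_~>next_))%prog.

Lemma search_spec V r s o : inputs s -> hist V r s -> (r < n)%N ->
  env s r_ = Idx r.+1 -> first (node s) V o -> env s cur_ = Ptr o ->
  env s prv_ = Ptr None ->
  runs search_loop s (50 * r.+1) (fun s' => exists p c,
    [/\ gap (node s) V (x r) p c, env s' prv_ = Ptr p & env s' cur_ = Ptr c]).
Proof.
move=> inp hs rn er ho ec ep.
(* A null [p] means that [c] is still the start of the list; otherwise [c] is the successor of [p],
   and [p] lies below the new value. *)
pose I k s' := exists p c, [/\ env s' prv_ = Ptr p, env s' cur_ = Ptr c,
  if p is Some i then [/\ node s i, V i < x r & nxt (node s) V i c]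
  else first (node s) V c, (if c is Some i then node s i else True) &
  (num x 0 r (predC (before V c)) <= k)%N].
apply: (@runs_while _ _ _ _ I 20 r) => //=.
- exists None, o; split=> //; first by case: o ho {ec} => [h []|].
  by rewrite (leq_trans (num_le _ _ _ _)) ?subn0.
- move=> k s' [p [c [ep' ec' hp hc hk]]] fr.
  have inp' := inputs_frame fr isT inp.
  have er' : env s' r_ = Idx r.+1 by rewrite (frame_var fr).
  have hh := frame_no_new fr isT.
  rewrite !evalE /= ec' er' /= (in_size inp') addn0 subn1 /= rn (in_F inp' rn).
  case: c ec' hp hc hk => [c|] ec' hp hc hk /=; last first.
    by exists false; split=> //; exists p, None; split.
  rewrite hh -/(node s c) hc (frame_fld fr) // (hist_val hs hc) /=.
  exists (~~ (x r <= V c)); split=> //; case: leP => /= [xc|cx].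
    by exists p, (Some c); split.
  have [[o' eo' ho'] _] := hist_linked hs hc.
  apply: runs_straight => //=.
    by rewrite !evalE ec' /= ec' hh -/(node s c) hc.
  exists (num x 0 r (predC (before V o'))).
    apply: leq_trans hk; apply: before_decreases ho' _.
      exact: hist_covers hs.
    exact: hist_pos hs _ hc.
  exists (Some c), o'; rewrite /= fld_set_var (frame_fld fr) // eo'; split=> //.
  by case: o' ho' {eo'} => [q []|].
- by lia.
Qed.

Lemma hist_increase V r s c : hist V r s -> node s c -> V c = x r ->
  (r < size (arrays s I_))%N ->
  hist V r.+1 (set_cel (set_fld s c weight_
    (Real ((num x 0 r (pred1 (V c)))%:R + 1))) I_ r (Ptr (Some c))).
Proof.
move=> [hv hw hi hs hp hI hh hl] hc Vc rI.
set s' := set_cel _ _ _ _.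
have eN : node s' = node s by rewrite /node !sizeE.
have eF k fd : (fd != weight_) -> fld s' k fd = fld s k fd.
  by move=> h; rewrite !fldE (negPf h) andbF.
split; rewrite ?eN //.
- by move=> k hk; rewrite eF ?hv.
- move=> k hk; rewrite !fldE eqxx andbT num_recr //= -Vc.
  case: eqP => [->|ne]; first by rewrite eqxx natrD.
  have -> : (V c == V k) = false by apply/eqP => /(hi _ _ hc hk)/esym.
  by rewrite hw // addn0.
- by rewrite !sizeE // leqW.
- by move=> k hk; rewrite num_recr // addn_gt0 hp.
- move=> j; rewrite ltnS leq_eqVlt => /predU1P[->|jr].
    by exists c; split=> //; rewrite cel_set_cel // !eqxx.
  have [k [hk Vk ck]] := hI j jr; exists k; split=> //.
  by rewrite cel_set_cel // (ltn_eqF jr) andbF.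
- by move=> k hk; rewrite !eF //; apply: hl.
Qed.

(** The store reached when a node is created, built in the order of the assignments so that symbolic
    execution ends in this very term. *)
Definition link_new s (y w : R) (p c : option nat) : store R :=
  let N := Some (size (heap s)) in
  let s1 := set_fld (new_node s new_) (size (heap s)) value_ (Real y) in
  let s2 := set_fld s1 (size (heap s)) weight_ (Real w) in
  let s3 := set_fld s2 (size (heap s)) prev_ (Ptr p) in
  let s4 := set_fld s3 (size (heap s)) next_ (Ptr c) in
  let s5 := if p is Some i then set_fld s4 i next_ (Ptr N)
            else set_var s4 head_ (Ptr N) in
  if c is Some i then set_fld s5 i prev_ (Ptr N) else s5.

Lemma hist_link_new V r s p c : hist V r s ->
  (forall k, node s k -> V k != x r) -> gap (node s) V (x r) p c ->
  (r < size (arrays s I_))%N ->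
  hist (upd V (size (heap s)) (x r)) r.+1
    (set_cel (link_new s (x r) 1 p c) I_ r (Ptr (Some (size (heap s))))).
Proof.
move=> [hv hw hi hs hp hI hh hl] neq hgap rI.
set N := size (heap s); set s' := set_cel _ _ _ _; set V' := upd V N (x r).
have nodeN k : node s k -> (k == N) = false by move=> hk; rewrite ltn_eqF.
have pN i : p = Some i -> node s i by case: hgap => + _ => /[swap] -> [].
have cN i : c = Some i -> node s i by case: hgap => _ + => /[swap] -> [].
have eA : arrays (link_new s (x r) 1 p c) = arrays s.
  by rewrite /link_new; case: (p); case: (c).
have eS : size (heap s') = N.+1.
  rewrite !sizeE /link_new.
  case: (p) pN => [i /(_ i erefl) hi'|_]; case: (c) cN => [j /(_ j erefl) hj|_];
  rewrite /=; do ?[by rewrite size_new_node|by rewrite size_new_node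
    ltnW|rewrite size_set_fld].
have eq_SomeC i k : (Some i == Some k) = (k == i) by rewrite eq_sym.
have [eV eW eX eP] : [/\
    forall k, fld s' k value_ =
      if k == N then Real (x r) else fld (new_node s new_) k value_,
    forall k, fld s' k weight_ =
      if k == N then Real 1 else fld (new_node s new_) k weight_,
    forall k, fld s' k next_ = if p == Some k then Ptr (Some N) else
      if k == N then Ptr c else fld (new_node s new_) k next_ &
    forall k, fld s' k prev_ = if c == Some k then Ptr (Some N) else
      if k == N then Ptr p else fld (new_node s new_) k prev_].
  rewrite /s' /link_new; split=> k; rewrite fld_set_cel;
  by case: (p); case: (c) => [j|] *;
    rewrite /= !fldE /= ?eq_SomeC ?andbT ?andbF.
have eH : env s' head_ = if p is Some i then env s head_ else Ptr (Some N).
  rewrite /s' /link_new env_set_cel.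
  by case: (p); case: (c) => [j|] *; rewrite /= ?env_set_fld ?env_new_node.
have old k fd : node s k -> fld (new_node s new_) k fd = fld s k fd.
  by move=> hk; rewrite fld_new_node.
have nodeE k : node s' k -> k = N \/ node s k.
  by rewrite /node eS ltnS leq_eqVlt => /predU1P.
have nodeS k : node s k -> node s' k by rewrite /node eS => /ltnW.
have Vold k : node s k -> V' k = V k by move=> hk; rewrite /V' /= nodeN.
have VN : V' N = x r by rewrite /V' /= eqxx.
have pNN : (p == Some N) = false by apply/eqP => /pN; rewrite /node ltnn.
have cNN : (c == Some N) = false by apply/eqP => /cN; rewrite /node ltnn.
(* The value is new: none of the first [r] data equals it, so the weight 1 of the new node is its
   full count. *)
have num0 : num x 0 r (pred1 (x r)) = 0%N.
  apply/eqP; rewrite -leqn0 leqNgt; apply/negP => /num_gt0P[j hj /= /eqP jr].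
  have [k [hk Vk _]] := hI j hj; have := neq k hk.
  by rewrite Vk jr eqxx.
have hcov : covers x 0 r (node s) V.
  by move=> j /hI[k [hk <- _]]; exists k.
have gapV : gap (node s) V' (x r) p c.
  by apply: eq_gap hgap => i hi'; rewrite Vold.
have injV' : {in node s &, injective V'}.
  by move=> i j hi' hj; rewrite !Vold //; exact: hi.
have neqV' i : node s i -> V' i != V' N by move=> hi'; rewrite VN Vold ?neq.
have nxtN : nxt (node s) V' N c.
  by apply: gap_nxt VN _ gapV => i hi'; rewrite Vold ?neq.
have prvN : prv (node s) V' N p by exact: gap_prv VN gapV.
have nodeU i : predU1 N (node s) i = node s' i.
  by rewrite /node eS ltnS [RHS]leq_eqVlt.
split.
- by move=> k /nodeE[->|hk]; rewrite eV ?eqxx ?VN // nodeN // old // hv ?Vold.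
- move=> k /nodeE[->|hk]; rewrite eW num_recr //=.
    by rewrite VN !eqxx num0.
  by rewrite nodeN // old // Vold // hw // eq_sym (negPf (neq k hk)) addn0.
- move=> i j /nodeE[->|hi'] /nodeE[->|hj] //; rewrite ?VN ?Vold //.
  + by move=> e; have := neq j hj; rewrite e eqxx.
  + by move=> e; have := neq i hi'; rewrite e eqxx.
  + exact: hi.
- by rewrite eS ltnS.
- move=> k /nodeE[->|hk]; rewrite num_recr //= ?VN ?eqxx ?addn1 // Vold //.
  by rewrite addn_gt0 hp.
- move=> j; rewrite ltnS leq_eqVlt => /predU1P[->|jr].
    exists N; rewrite /s' cel_set_cel ?eA // !eqxx /=; split=> //.
    by rewrite /node eS.
  have [k [hk Vk ck]] := hI j jr; exists k; split; rewrite ?Vold //.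
    exact: nodeS.
  by rewrite /s' cel_set_cel ?eA // (ltn_eqF jr) andbF /link_new; case: (p);
    case: (c).
- rewrite eH; case: hh => o eo fo; move: hgap => [+ hc].
  case ep: p => [i|].
    case=> hi' ilt _; exists o => //;
      case: o {eo} fo => [h [hh least]|/(_ i)]; last first.
      by rewrite hi'.
    split; first exact: nodeS.
    move=> j /nodeE[->|hj]; rewrite ?VN ?Vold //; last exact: least.
    by rewrite (le_trans (least i hi')) // ltW.
  move=> hf; exists (Some N) => //; split; first by rewrite /node eS.
  move=> j /nodeE[->|hj]; rewrite VN ?Vold //.
  move: hf hc; case: (c) => [i [_ least] [_ hri]|/(_ j)].
    by rewrite (le_trans hri) ?least.
  by rewrite hj.
- move=> k /nodeE[->|hk]; split.
  + exists c; rewrite ?eX ?pNN ?eqxx //.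
    by apply: eq_nxt (nxt_insert_self nxtN) => // i; rewrite nodeU.
  + exists p; rewrite ?eP ?cNN ?eqxx //.
    by apply: eq_nxt (nxt_insert_self prvN) => // i; rewrite nodeU.
  + have [[o eo ho] _] := hl k hk.
    exists (if p == Some k then Some N else o).
      by rewrite eX nodeN // old // eo; case: ifP.
    apply: (@eq_nxt _ (predU1 N (node s)) _ V') => // [i|i|]; rewrite ?nodeU //.
    apply: nxt_insert prvN nxtN _ => //.
    by apply: eq_nxt ho => // [|i hi']; rewrite Vold.
  (* Predecessors are successors for [- V'], with [p] and [c] exchanging roles. *)
  + have [_ [o eo ho]] := hl k hk.
    exists (if c == Some k then Some N else o).
      by rewrite eP nodeN // old // eo; case: ifP.
    apply: (@eq_nxt _ (predU1 N (node s)) _ (fun i => - V' i)) => // [i|i|];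
      rewrite ?nodeU //.
    apply: nxt_insert prvN _ => //.
    * by move=> i j hi' hj /oppr_inj; exact: injV'.
    * by move=> i hi'; rewrite eqr_opp neqV'.
    * by apply: eq_nxt nxtN => // [|i _]; rewrite opprK.
    * by apply: eq_nxt ho => // [|i hi']; rewrite Vold.
Qed.

End Histogram.

(** * Insertion of a datum *)

Section Insertion.
Local Open Scope ring_scope.
Variables (R : realDomainType) (n : nat) (x : nat -> R) (gamma : R).
Implicit Types (s : store R) (V : nat -> R) (A : pred nat) (o : option nat).
Local Notation inputs := (inputs n x gamma).
Local Notation hist := (hist x).

Definition insert_new : cmd :=
  (New new_ ;;
    new_~>value_ <~ F_.[r_ - 1%N] ;;
    new_~>weight_ <~ W_.[r_ - 1%N] ;;
    new_~>prev_ <~ prv_ ;;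
    new_~>next_ <~ cur_ ;;
    If (prv_ == Null) (head_ <~ new_) (prv_~>next_ <~ new_) ;;
    If (cur_ == Null) Skip (cur_~>prev_ <~ new_) ;;
    I_.[r_ - 1%N] <~ new_)%prog.

Lemma straight_insert_new s r p c : inputs s -> (r < n)%N ->
  env s r_ = Idx r.+1 -> env s prv_ = Ptr p -> env s cur_ = Ptr c ->
  (forall i, p = Some i -> node s i) -> (forall i, c = Some i -> node s i) ->
  straight s insert_new =
  Some (set_cel (link_new s (x r) 1 p c) I_ r (Ptr (Some (size (heap s))))).
Proof.
move=> inp rn er ep ec hp hc; rewrite /insert_new /link_new.
have hz a : (r < size (arrays s a))%N by rewrite (in_size inp) ltn_addr.
have {}hp : if p is Some i then node s i else true by case: p hp {ep} =>
  // i ->.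
have {}hc : if c is Some i then node s i else true by case: c hc {ec} =>
  // i ->.
have hF : (r < size (arrays s F_))%N by rewrite (in_size inp) addn0.
have hW : (r < size (arrays s W_))%N by rewrite (in_size inp) addn0.
have hI : (r < size (arrays s I_))%N by rewrite (in_size inp) addn0.
have eF := in_F inp rn; have eW := in_W inp rn.
by case: p c ep ec hp hc => [i|] [j|] ep ec hp hc;
  rewrite /node in hp hc; simulate.
Qed.

Lemma insert_spec V r s : inputs s -> hist V r s -> (r < n)%N ->
  env s r_ = Idx r.+1 ->
  runs insert_datum s (200 * r.+1) (fun s' => exists V', hist V' r.+1 s').
Proof.
move=> inp hs rn er; have [o eo fo] := hist_head hs.
pose s1 := set_var s cur_ (Ptr o); pose s2 := set_var s1 prv_ (Ptr None).
rewrite /insert_datum -/search_loop -/insert_new.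
apply: (@runs_step _ _ _ _ s1) => // [|fr1|]; [by simulate| |by rewrite /=;
  lia].
apply: (@runs_step _ _ _ _ s2) => //= [fr2|]; last by lia.
have fr := frame_seq fr1 fr2.
have inp2 := inputs_frame fr isT inp.
have hs2 := hist_frame fr isT isT hs.
have found : runs search_loop s2 (50 * r.+1) _ := search_spec inp2 hs2 rn er fo
  erefl erefl.
apply: (runs_seq (T2 := 100) _ found) => // [|]; last by lia.
move=> {hs inp fr fr1 fr2} s3 fr3 [p [c [hgap ep ec]]].
have inp := inputs_frame fr3 isT inp2; have hs := hist_frame fr3 isT isT hs2.
rewrite -(node_frame fr3 isT) in hgap.
have {}er : env s3 r_ = Idx r.+1 by rewrite (frame_var fr3).
have hF : (r < size (arrays s3 F_))%N by rewrite (in_size inp) addn0.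
have hW : (r < size (arrays s3 W_))%N by rewrite (in_size inp) addn0.
have hI : (r < size (arrays s3 I_))%N by rewrite (in_size inp) addn0.
have eF := in_F inp rn; have eW := in_W inp rn.
(* Shared by the two ways of missing the value: the list ends, or the search stops at a larger
   one. *)
have add_new : (forall k, node s3 k -> V k != x r) ->
    runs insert_new s3 70 (fun s' => exists V', hist V' r.+1 s').
  move=> neq; apply: runs_straight => //.
    apply: straight_insert_new er ep ec _ _ => //.
      by case: hgap => + _ i ei; rewrite ei => -[].
    by case: hgap => _ + i ei; rewrite ei => -[].
  by eexists; exact: hist_link_new hs neq hgap hI.
case: c ec hgap => [i|] ec hgap; last first.
  apply: (@runs_if _ _ _ _ _ 70 _ _ false) => //; first by simulate.
  apply: add_new => k hk; case: p {ep} hgap => [j [[hj jr +] _]|[/(_ k) + _]];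
    last by move/negP/(_ hk).
  by move=> /(_ k hk) kj; rewrite lt_eqF //; exact: le_lt_trans kj jr.
have [_ [hi ri]] := hgap.
have hi' : (i < size (heap s3))%N := hi.
have ev := hist_val hs hi; have ew := hist_weight hs hi.
apply: (@runs_if _ _ _ _ _ 70 _ _ (V i == x r)) => //; first by simulate.
case: eqP => [eVi|/eqP ne].
  apply: runs_straight => //; first by simulate.
  by exists V; apply: hist_increase.
(* A node holding [x r] would come after the last node passed, hence at or above [i]; as
   [x r <= V i], both values would coincide. *)
apply: add_new => k hk; apply: contra_neq ne => ek.
apply/le_anti; rewrite ri andbT -ek.
case: p {ep} hgap => [j [[hj jr [_ _ +]] _]|[[_ +] _]]; apply=> //.
by rewrite ek.
Qed.

End Insertion.

(** * Traversals of the histogram *)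

Section Median.
Local Open Scope ring_scope.
Variables (R : realDomainType) (n : nat) (x : nat -> R) (gamma : R).
Implicit Types (s : store R) (V : nat -> R) (A : pred nat) (o : option nat).
Local Notation inputs := (inputs n x gamma).
Local Notation hist := (hist x).

(** Indexing the invariant by the cursor makes it speak of the whole list at the null pointer. There
    are at most [r] rounds, each costing the body plus 5 for the test. *)
Lemma runs_traverse c V r s0 o (I : option nat -> store R -> Prop) B T
    (Q : store R -> Prop) :
  no_alloc c -> no_new c -> hist V r s0 -> first (node s0) V o ->
  env s0 cur_ = Ptr o -> I o s0 ->
  (forall i s o', node s0 i -> I (Some i) s -> env s cur_ = Ptr (Some i) ->
     frame c s0 s -> fld s0 i next_ = Ptr o' -> nxt (node s0) V i o' ->
     runs c s B (fun s' => I o' s' /\ env s' cur_ = Ptr o')) ->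
  (forall s, frame c s0 s -> I None s -> Q s) ->
  (r * (B + 5) + 5 <= T)%N ->
  runs (While (cur_ != Null)%prog c) s0 T Q.
Proof.
move=> na nn hs fo eo hI step end_ hT.
pose J k s := exists o, [/\ env s cur_ = Ptr o, I o s,
  (if o is Some i then node s0 i else true) &
  (num x 0 r (predC (before V o)) <= k)%N].
apply: (@runs_while _ _ _ _ J B r) => //=; last by lia.
- exists o; split=> //; first by case: o fo {eo hI} => // i [].
  by rewrite (leq_trans (num_le _ _ _ _)) ?subn0.
- move=> k s [[i|] [ei hIi hi hk]] fr; rewrite ei /=; last first.
    by exists false; split=> //; exact: end_.
  exists true; split=> //; have [[o' eo' ho'] _] := hist_linked hs hi.
  apply: runs_weaken (step i s o' hi hIi ei fr eo' ho') (leqnn _) _.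
  move=> s' [hI' ec']; exists (num x 0 r (predC (before V o'))).
    apply: leq_trans hk; apply: before_decreases ho' _.
      exact: hist_covers hs.
    exact: hist_pos hs _ hi.
  by exists o'; split=> //; case: o' ho' {eo' hI' ec'} => // j [].
Qed.

(** When the cursor leaves [i], the only node newly passed is [i]; this serves invariants stated
    node by node, as in the reset of the temporary fields. *)
Lemma before_next_node V A i o k : {in A &, injective V} -> A i -> A k ->
  nxt A V i o -> before V o (V k) -> k = i \/ before V (Some i) (V k).
Proof.
move=> injV Ai Ak hn hb; have hle : V k <= V i.
  case: o hn hb => [q [_ _ least]|least _] /=; last exact: least.
  by rewrite ltNge => /negP h; rewrite leNgt; apply/negP => /(least k Ak).
by case: (eqVneq (V k) (V i)) => [/injV->//|ne]; [left|right;
  rewrite /= lt_neqAle ne].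
Qed.

Lemma partial_sum_nxt A V l r i o g : covers x l r A V -> nxt A V i o ->
  partial_sum x l r (before V o) g =
  partial_sum x l r (before V (Some i)) g + (num x l r (pred1 (V i)))%:R * g (V
    i).
Proof.
move=> cov h; rewrite -partial_sum_lt_le; apply: eq_partial_sum => j hj.
exact: before_nxt cov h hj.
Qed.

Lemma partial_sum_first A V l r o g : covers x l r A V -> first A V o ->
  partial_sum x l r (before V o) g = 0.
Proof.
move=> cov h; rewrite (eq_partial_sum (P' := pred0));
  first by rewrite /partial_sum big_pred0_eq.
by move=> j; exact: before_first cov h _.
Qed.

(** Weights are known for all nodes, removed ones having weight 0. Links are asserted on [A], which
    right after a removal is still the set of nodes live before it. *)
Record temporary V l r A s : Prop := Temporary {
  temp_weight : forall k, node s k ->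
    fld s k tweight_ = Real (num x l r (pred1 (V k)))%:R;
  temp_linked : linked s tnext_ tprev_ A
    (fun k => node s k && (0 < num x l r (pred1 (V k)))%N) V }.

Lemma reset_spec V r s : hist V r s ->
  runs reset_temporary s (100 * r.+1) (fun s' =>
    temporary V 0 r (node s) s' /\ env s' total_ = Real r%:R).
Proof.
move=> hs; have [o eo fo] := hist_head hs.
have cov : covers x 0 r (node s) V := hist_covers hs.
pose s1 := set_var (set_var s total_ (Real 0)) cur_ (Ptr o).
apply: (@runs_step _ _ _ _ (set_var s total_ (Real 0))) => //= [_|];
  last by lia.
apply: (@runs_step _ _ _ _ s1) => //=; [by rewrite eo| |by lia].
move=> fr0.
have hs1 : hist V r s1 by case: hs.
pose I o s' := env s' total_ = Real (partial_sum x 0 r (before V o) (fun=> 1))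
  /\
  forall k, node s k -> before V o (V k) ->
    [/\ fld s' k tweight_ = fld s k weight_, fld s' k tnext_ = fld s k next_ &
        fld s' k tprev_ = fld s k prev_].
set c := (X in While _ X).
apply: (@runs_traverse c V r s1 o I 50 _ _ isT isT hs1) => //.
- split; first by rewrite /= (partial_sum_first _ cov fo).
  move=> k hk; move: fo; case: (o) => [h [hh least]|/(_ k)] /=;
    last by rewrite hk.
  by rewrite ltNge least.
- move=> i s' o' hi [et hI] ec fr eo' ho'.
  have hi' : (i < size (heap s'))%N by rewrite (frame_no_new fr).
  have ew : fld s' i weight_ = fld s i weight_ by rewrite (frame_fld fr).
  have ex : fld s' i next_ = fld s i next_ by rewrite (frame_fld fr).
  have ep : fld s' i prev_ = fld s i prev_ by rewrite (frame_fld fr).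
  have ew' := hist_weight hs hi.
  rewrite !fld_set_var in eo'.
  apply: runs_straight => //; first by rewrite /c; simulate.
  split=> //; split.
    by rewrite /= (partial_sum_nxt _ cov ho') mulr1.
  move=> k hk hb; rewrite !fld_set_var !fld_set_fld /= !andbT !andbF.
  case: (before_next_node (hist_inj hs) hi hk ho' hb) => [->|hb'].
    by rewrite eqxx eo' ew'.
  by case: eqP => [->|_]; [rewrite eo' ew'|exact: hI].
- move=> s' fr [et hI];
  have nodeE : node s' = node s by rewrite (node_frame fr).
  split; last first.
    by rewrite et /partial_sum /= sumr_const_nat subn0.
  split; rewrite nodeE.
    by move=> k hk; have [-> _ _] := hI k hk isT; exact: hist_weight hs _ hk.
  move=> k hk; have [_ -> ->] := hI k hk isT.
  have e i : node s i -> node s i && (0 < num x 0 r (pred1 (V i)))%N.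
    by move=> hi; rewrite hi (hist_pos hs).
  have [[o1 e1 h1] [o2 e2 h2]] := hist_linked hs hk.
  split; [exists o1 => //; apply: eq_nxt h1|exists o2 => //;
    apply: eq_nxt h2] => //;
  by move=> i /andP[].
- by rewrite /=; lia.
Qed.

Record pivot V l r m s : Prop := Pivot {
  pivot_med : env s med_ = Ptr (Some m);
  pivot_node : node s m;
  pivot_below : env s below_ = Real (num x l r (< V m))%:R;
  pivot_above : env s above_ = Real (num x l r (> V m))%:R }.

(** Free of truncated subtraction. It does not force [y] to be a datum; where this matters, a
    positive count is carried along. *)
Definition is_median l r y : Prop :=
  (num x l r (> y) <= num x l r (< y) + num x l r (pred1 y))%N /\
  (num x l r (< y) <= num x l r (> y) + num x l r (pred1 y))%N.

Lemma num_trichotomy l r y :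
  (num x l r (< y) + num x l r (pred1 y) + num x l r (> y) = r - l)%N.
Proof.
rewrite -num_le_lt -(num_predC x l r (<= y)); congr addn.
by apply: eq_num => j _ /=; rewrite ltNge.
Qed.

Lemma find_median_spec V r s : hist V r s -> (0 < r)%N ->
  env s total_ = Real r%:R ->
  runs find_median s (100 * r.+1)
    (fun s' => exists2 m, pivot V 0 r m s' & is_median 0 r (V m)).
Proof.
move=> hs r0 et; have [o eo fo] := hist_head hs.
have cov : covers x 0 r (node s) V := hist_covers hs.
case: o eo fo => [h eo [hh least]|eo none]; last first.
  by have [k [hk _ _]] := hist_I hs r0; have := none k; rewrite hk.
have ew := hist_weight hs hh; have hh' : (h < size (heap s))%N := hh.
have lt0 : num x 0 r (< V h) = 0%N.
  apply/eqP; rewrite -leqn0 leqNgt; apply/negP => /num_gt0P[j hj] /=.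
  by have [k hk <-] := cov j hj; rewrite ltNge least.
have gtE : (r%:R - (num x 0 r (pred1 (V h)))%:R : R) = (num x 0 r (> V h))%:R.
  by have := num_trichotomy 0 r (V h); rewrite lt0 subn0 add0n => {1}<-;
    rewrite natrD addrC addKr.
apply: (@runs_step _ _ _ _ (set_var s med_ (Ptr (Some h)))) => //= [|_|];
  [by rewrite eo| |by lia].
apply: (@runs_step _ _ _ _ (set_var (set_var s med_ (Ptr (Some h))) below_
  (Real 0))) => //= [_|]; last by lia.
set s2 := set_var _ below_ _.
apply: (@runs_step _ _ _ _ (set_var s2 above_ (Real (num x 0 r (> V h))%:R)))
  => //=; [by rewrite /s2; simulate; rewrite gtE| |by lia].
move=> _; set s3 := set_var s2 _ _.
have hs3 : hist V r s3 by case: hs.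
(* One median inequality is invariant and the other is the exit condition: in an iteration, [below_]
   plus the weight is less than [above_], and after the move the former is the new [below_], the
   latter the new [above_] plus the new weight. *)
pose J k s' := exists m, [/\ pivot V 0 r m s',
  (num x 0 r (< V m) <= num x 0 r (> V m) + num x 0 r (pred1 (V m)))%N &
  (num x 0 r (> V m) <= k)%N].
apply: (@runs_while _ _ _ _ J 50 r) => //.
- exists h; split; first by split; rewrite // lt0.
    by rewrite lt0.
  by rewrite (leq_trans (num_le _ _ _ _)) ?subn0.
- move=> k s' [m [[em hm eb ea] hlow hk]] fr.
  have hm1 : node s m by rewrite (node_frame fr) in hm.
  have hm' : (m < size (heap s'))%N := hm.
  have ew1 : fld s' m weight_ = Real (num x 0 r (pred1 (V m)))%:R.
    by rewrite (frame_fld fr) // (hist_weight hs3 hm1).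
  exists ((num x 0 r (< V m) + num x 0 r (pred1 (V m)) < num x 0 r (> V m))%N).
  split; first by simulate; rewrite -natrD ler_nat -ltnNge.
  case: ltnP => hlt; last by exists m.
  have [[[m1|] e1 h1] _] := hist_linked hs hm1; last first.
    by case: (nxt_none cov _ h1); exact: leq_trans hlt.
  have hm2 : node s m1 by case: h1.
  have hm2' : (m1 < size (heap s'))%N by rewrite (frame_no_new fr).
  have e1' : fld s' m next_ = Ptr (Some m1) by rewrite (frame_fld fr).
  have ew2 : fld s' m1 weight_ = Real (num x 0 r (pred1 (V m1)))%:R.
    by rewrite (frame_fld fr) // (hist_weight hs3 hm2).
  have pos := hist_pos hs hm2.
  apply: runs_straight => //; first by simulate.
  have := num_lt_nxt cov h1; have := num_gt_nxt cov h1 => egt elt.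
  exists (num x 0 r (> V m1)); first by lia.
  exists m1; split=> //; last by lia.
  split=> //=; first by rewrite -natrD elt.
  by rewrite egt natrD addrK.
- by rewrite /=; lia.
Qed.

Lemma sum_distances_spec V r s m : hist V r s -> node s m ->
  env s med_ = Ptr (Some m) ->
  runs sum_distances s (100 * r.+1)
    (fun s' => env s' dist_ = Real (dev x 0 r (V m))).
Proof.
move=> hs hm em; have [o eo fo] := hist_head hs.
have cov : covers x 0 r (node s) V := hist_covers hs.
pose s1 := set_var (set_var s dist_ (Real 0)) cur_ (Ptr o).
apply: (@runs_step _ _ _ _ (set_var s dist_ (Real 0))) => //= [_|]; last by lia.
apply: (@runs_step _ _ _ _ s1) => //=; [by rewrite eo| |by lia].
move=> fr0.
have hs1 : hist V r s1 by case: hs.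
pose I o s' := env s' dist_ =
  Real (partial_sum x 0 r (before V o) (fun y => `|y - V m|)).
set c := (X in While _ X).
apply: (@runs_traverse c V r s1 o I 50 _ _ isT isT hs1) => //.
- by rewrite /I /= (partial_sum_first _ cov fo).
- move=> i s' o' hi hI ec fr eo' ho'.
  have hi' : (i < size (heap s'))%N by rewrite (frame_no_new fr).
  have hm' : (m < size (heap s'))%N by rewrite (frame_no_new fr).
  have ew : fld s' i weight_ = Real (num x 0 r (pred1 (V i)))%:R.
    by rewrite (frame_fld fr) // !fld_set_var (hist_weight hs).
  have ev : fld s' i value_ = Real (V i).
    by rewrite (frame_fld fr) // !fld_set_var (hist_val hs).
  have ev' : fld s' m value_ = Real (V m).
    by rewrite (frame_fld fr) // !fld_set_var (hist_val hs).
  have ex : fld s' i next_ = Ptr o' by rewrite (frame_fld fr).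
  have em' : env s' med_ = Ptr (Some m) by rewrite (frame_var fr).
  rewrite /I in hI.
  apply: runs_straight => //; first by rewrite /c; simulate.
  by split=> //=; rewrite /I /= (partial_sum_nxt _ cov ho').
- by rewrite /=; lia.
Qed.

End Median.

(** * Removal of a datum *)

Section Removal.
Local Open Scope ring_scope.
Variables (R : realDomainType) (n : nat) (x : nat -> R) (gamma : R).
Implicit Types (s : store R) (V : nat -> R) (A : pred nat) (o : option nat).
Local Notation inputs := (inputs n x gamma).
Local Notation hist := (hist x).
Local Notation temporary := (temporary x).
Local Notation pivot := (pivot x).
Local Notation is_median := (is_median x).

Definition alive V l r s : pred nat :=
  fun k => node s k && (0 < num x l r (pred1 (V k)))%N.

Definition unlink : cmd :=
  (If (cur_~>tweight_ == Zero) (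
    If (cur_~>tprev_ == Null) Skip (cur_~>tprev_~>tnext_ <~ cur_~>tnext_) ;;
    If (cur_~>tnext_ == Null) Skip (cur_~>tnext_~>tprev_ <~ cur_~>tprev_)
  ) Skip)%prog.

Definition unlinked s (p q : option nat) : store R :=
  let s1 := if p is Some i then set_fld s i tnext_ (Ptr q) else s in
  if q is Some j then set_fld s1 j tprev_ (Ptr p) else s1.

(** On entry the temporary weights reflect the removal and the links do not. If [c] retains weight,
    the live nodes are unchanged; otherwise they lose exactly [c]. *)
Lemma unlink_spec V l r s c : hist V r s -> (l < r)%N ->
  env s cur_ = Ptr (Some c) -> node s c -> V c = x l ->
  (forall k, node s k ->
     fld s k tweight_ = Real (num x l.+1 r (pred1 (V k)))%:R) ->
  linked s tnext_ tprev_ (alive V l r s) (alive V l r s) V ->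
  runs unlink s 50 (temporary V l.+1 r (alive V l r s)).
Proof.
move=> hs lr ec hc eV hw hl.
have hc' : (c < size (heap s))%N := hc.
have ew := hw c hc.
have numS k : num x l r (pred1 (V k)) =
    ((V c == V k) + num x l.+1 r (pred1 (V k)))%N.
  by rewrite num_ltn // eV.
have Ac : alive V l r s c by rewrite /alive hc numS eqxx.
have injA : {in alive V l r s &, injective V}.
  by move=> i j /andP[hi _] /andP[hj _]; exact: hist_inj hs _ _ hi hj.
apply: (@runs_if _ _ _ _ _ 40 _ _ (num x l.+1 r (pred1 (V c)) == 0%N)) => //.
  by simulate; rewrite pnatr_eq0.
case: eqP => [w0|/eqP w0]; last first.
  apply: (@runs_straight _ _ _ s) => //; split=> // k hk.
  have aliveE i : alive V l r s i ->
      node s i && (0 < num x l.+1 r (pred1 (V i)))%N.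
    by move=> /andP[->]; rewrite numS; case: eqP => [<- _|//]; rewrite lt0n.
  have aliveW i : node s i && (0 < num x l.+1 r (pred1 (V i)))%N ->
      alive V l r s i.
    by move=> /andP[hi hp]; rewrite /alive hi numS addn_gt0 hp orbT.
  have [[o1 e1 h1] [o2 e2 h2]] := hl k hk.
  split; [exists o1|exists o2] => //.
    exact: eq_nxt aliveE aliveW _ _ h1.
  exact: eq_nxt aliveE aliveW _ _ h2.
have [[oq eq_ hq] [op ep hp]] := hl c Ac.
have aliveD i : predD1 (alive V l r s) c i =
    node s i && (0 < num x l.+1 r (pred1 (V i)))%N.
  rewrite /= /alive numS; case: (eqVneq i c) => [->|ne] /=;
    first by rewrite w0 andbF.
  case hi: (node s i) => //=; case: eqP => //= e.
  by case/eqP: ne; exact/esym/(hist_inj hs hc hi).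
(* The neighbours differ from [c], so writing their pointers leaves intact those of [c], which the
   second conditional still reads. *)
have pc i : op = Some i -> node s i /\ (c == i) = false.
  move=> e; move: hp; rewrite e => -[/andP[hi _] lt_ci _]; split=> //.
  by apply/eqP => ci; move: lt_ci; rewrite ci ltxx.
have qc i : oq = Some i -> node s i /\ (c == i) = false.
  move=> e; move: hq; rewrite e => -[/andP[hi _] lt_ci _]; split=> //.
  by apply/eqP => ci; move: lt_ci; rewrite ci ltxx.
apply: (@runs_straight _ _ _ (unlinked s op oq)) => //.
  rewrite /unlinked; move: eq_ ep pc qc.
  case: (op) => [i|] eq_ ep pc qc; case: (oq) eq_ qc => [j|] eq_ qc;
  rewrite /node in pc qc.
  + have [hi ci] := pc i erefl; have [hj cj] := qc j erefl.
    by rewrite /=; do ?[simulate_step|rewrite ci].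
  + have [hi ci] := pc i erefl.
    by rewrite /=; do ?[simulate_step|rewrite ci].
  + have [hj cj] := qc j erefl.
    by rewrite /=; do ?[simulate_step|rewrite cj].
  + by simulate.
have eS : size (heap (unlinked s op oq)) = size (heap s).
  rewrite /unlinked; case: (op) pc => [i /(_ i erefl)[hi _]|_];
  case: (oq) qc => [j /(_ j erefl)[hj _]|_]; rewrite ?size_set_fld //.
have eX k : fld (unlinked s op oq) k tnext_ =
    if op == Some k then Ptr oq else fld s k tnext_.
  by rewrite /unlinked; case: (op) => [i|]; case: (oq) => [j|];
     rewrite ?fld_set_fld /= ?andbF ?andbT // eq_sym.
have eP k : fld (unlinked s op oq) k tprev_ =
    if oq == Some k then Ptr op else fld s k tprev_.
  by rewrite /unlinked; case: (op) => [i|]; case: (oq) => [j|];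
     rewrite ?fld_set_fld /= ?andbF ?andbT // eq_sym.
have eW k : fld (unlinked s op oq) k tweight_ = fld s k tweight_.
  by rewrite /unlinked; case: (op) => [i|]; case: (oq) => [j|];
     rewrite ?fld_set_fld /= ?andbF.
split; rewrite /node eS; first by move=> k hk; rewrite eW hw.
move=> k hk; have [[o1 e1 h1] [o2 e2 h2]] := hl k hk.
split; [exists (if op == Some k then oq else o1)|exists (if oq == Some k then
  op else o2)].
- by rewrite eX e1; case: ifP.
- apply: eq_nxt (nxt_remove injA Ac hk hp hq h1) => // i; rewrite -aliveD //.
- by rewrite eP e2; case: ifP.
(* For the backward links the removal lemma is applied to [- V], where the two neighbours trade
   places. *)
- have inj' : {in alive V l r s &, injective (fun k => - V k)}.
    by move=> i j hi hj /oppr_inj; exact: injA.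
  have hq' : nxt (alive V l r s) (fun k => - - V k) c oq.
    by apply: eq_nxt hq => // [|i _]; rewrite opprK.
  by apply: eq_nxt (nxt_remove inj' Ac hk hq' hp h2) => // i; rewrite -aliveD.
Qed.

Lemma alive_frame c V l r s s' : frame c s s' -> no_new c ->
  alive V l r s' = alive V l r s.
Proof. by move=> fr nn; rewrite /alive (node_frame fr nn). Qed.

Definition adjust_below : cmd :=
  (If (cur_~>value_ < med_~>value_) (below_ <~ below_ - W_.[l_ - 1%N])
    Skip)%prog.

Definition adjust_above : cmd :=
  (If (med_~>value_ < cur_~>value_) (above_ <~ above_ - W_.[l_ - 1%N])
    Skip)%prog.

Lemma remove_spec V l r s m : inputs s -> hist V r s -> (l < r)%N -> (r <= n)%N
  ->
  env s l_ = Idx l.+1 -> temporary V l r (alive V l r s) s -> pivot V l r m s ->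
  env s dist_ = Real (dev x l r (V m)) ->
  runs remove_datum s 200 (fun s' => [/\ temporary V l.+1 r (alive V l r s) s',
    pivot V l.+1 r m s' & env s' dist_ = Real (dev x l.+1 r (V m))]).
Proof.
move=> inp hs lr rn el [hw hl] [em hm eb ea] ed.
have [c [hc eV eI]] := hist_I hs lr.
have ln : (l < n)%N := leq_trans lr rn.
have hz s' : inputs s' -> forall a, (l < size (arrays s' a))%N.
  by move=> inp' a; rewrite (in_size inp') ltn_addr.
have hI := hz s inp I_; have hW := hz s inp W_; have eW := in_W inp ln.
have hm' : (m < size (heap s))%N := hm; have hc' : (c < size (heap s))%N := hc.
have ew := hw c hc; have ev := hist_val hs hc; have evm := hist_val hs hm.
rewrite /remove_datum -/unlink -/adjust_below -/adjust_above.
pose s1 := set_var s cur_ (Ptr (Some c)).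
pose s2 := set_fld s1 c tweight_ (Real ((num x l r (pred1 (V c)))%:R - 1)).
pose s3 := set_var s2 dist_ (Real (dev x l r (V m) - 1 * `|V c - V m|)).
apply: (@runs_step _ _ _ _ s1) => //= [|f1]; first by simulate.
apply: (@runs_step _ _ _ _ s2) => //= [|f2]; first by rewrite /s1; simulate.
apply: (@runs_step _ _ _ _ s3) => //= [|f3]; first by rewrite /s2 /s1; simulate.
have fr := frame_seq f1 (frame_seq f2 f3).
have inp3 := inputs_frame fr isT inp.
have hs3 := hist_frame fr isT isT hs.
have ed3 : env s3 dist_ = Real (dev x l.+1 r (V m)).
  by rewrite /= mul1r (dev_ltn x (V m) lr) eV addrAC subrr add0r.
have hw3 k : node s k -> fld s3 k tweight_ = Real (num x l.+1 r (pred1 (V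
  k)))%:R.
  move=> hk; rewrite /s3 /s2 !fldE /= andbT (num_ltn _ _ lr) /= -eV.
  case: (k =P c) => [->|ne]; first by rewrite eqxx natrD addrAC subrr add0r.
  rewrite hw // num_ltn //= -eV.
  by have -> : (V c == V k) = false by apply/eqP => /(hist_inj hs hc hk)/esym.
have eN3 : node s3 = node s := node_frame fr isT.
have ec3 : env s3 cur_ = Ptr (Some c) by [].
have em3 : env s3 med_ = Ptr (Some m) by [].
have el3 : env s3 l_ = Idx l.+1 by [].
have eb3 : env s3 below_ = Real (num x l r (< V m))%:R by [].
have ea3 : env s3 above_ = Real (num x l r (> V m))%:R by [].
have hl3 : linked s3 tnext_ tprev_ (alive V l r s) (alive V l r s) V.
  by move=> k hk; rewrite /s3 /s2 !fldE !andbF; exact: hl.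
clearbody s3; clear s1 s2 f1 f2 f3 fr.
(* Stated for any suitable store, since the two adjustments start from different ones. *)
have adjust_ok s' : hist V r s' -> inputs s' -> node s' = node s ->
    env s' cur_ = Ptr (Some c) -> env s' med_ = Ptr (Some m) ->
    env s' l_ = Idx l.+1 ->
  (env s' below_ = Real (num x l r (< V m))%:R -> runs adjust_below s' 40
    (fun s' => env s' below_ = Real (num x l.+1 r (< V m))%:R)) /\
  (env s' above_ = Real (num x l r (> V m))%:R -> runs adjust_above s' 40
    (fun s' => env s' above_ = Real (num x l.+1 r (> V m))%:R)).
  move=> hs' inp' eN' ec' em' el'.
  have hW' := hz s' inp' W_; have eW' := in_W inp' ln.
  have hm1 : node s' m by rewrite eN'.
  have hc1 : node s' c by rewrite eN'.
  have ev' := hist_val hs' hc1; have evm' := hist_val hs' hm1.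
  rewrite /node in hm1 hc1.
  split=> e'.
    apply: (@runs_if _ _ _ _ _ 20 _ _ (V c < V m)) => //.
      by simulate; rewrite -ltNge.
    have := num_ltn x (< V m) lr; rewrite /= -eV.
    case: ifP => _ e; last by apply: (@runs_straight _ _ _ s');
      rewrite //= e' e.
    apply: runs_straight => //; first by simulate.
    by rewrite /= e natrD addrAC subrr add0r.
  apply: (@runs_if _ _ _ _ _ 20 _ _ (V m < V c)) => //.
    by simulate; rewrite -ltNge.
  have := num_ltn x (> V m) lr; rewrite /= -eV.
  case: ifP => _ e; last by apply: (@runs_straight _ _ _ s'); rewrite //= e' e.
  apply: runs_straight => //; first by simulate.
  by rewrite /= e natrD addrAC subrr add0r.
apply: (runs_seq (T2 := 100) _ ((adjust_ok s3 hs3 inp3 eN3 ec3 em3 el3).1 eb3))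
  => //.
move=> s4 fr4 eb4.
have inp4 := inputs_frame fr4 isT inp3; have hs4 := hist_frame fr4 isT isT hs3.
have eN4 : node s4 = node s by rewrite (node_frame fr4).
have ec4 : env s4 cur_ = Ptr (Some c) by rewrite (frame_var fr4).
have em4 : env s4 med_ = Ptr (Some m) by rewrite (frame_var fr4).
have el4 : env s4 l_ = Idx l.+1 by rewrite (frame_var fr4).
have ea4 : env s4 above_ = Real (num x l r (> V m))%:R by rewrite (frame_var
  fr4).
apply: (runs_seq (T2 := 50) _ ((adjust_ok s4 hs4 inp4 eN4 ec4 em4 el4).2 ea4))
  => //.
move=> s5 fr5 ea5.
have hs5 := hist_frame fr5 isT isT hs4.
have eN5 : node s5 = node s by rewrite (node_frame fr5).
have eA : alive V l r s5 = alive V l r s by rewrite /alive eN5.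
have hn4 k : alive V l r s k -> node s4 k by rewrite eN4 => /andP[].
have hn3 k : alive V l r s k -> node s3 k by rewrite eN3 => /andP[].
have hl5 := linked_frame fr5 isT hn4 (linked_frame fr4 isT hn3 hl3).
have hw5 k : node s5 k -> fld s5 k tweight_ = Real (num x l.+1 r (pred1 (V
  k)))%:R.
  rewrite eN5 => hk; rewrite (frame_fld fr5) //;
    last by rewrite -/(node s4 k) eN4.
  by rewrite (frame_fld fr4) ?hw3 // -/(node s3 k) eN3.
have ec5 : env s5 cur_ = Ptr (Some c) by rewrite (frame_var fr5).
have hc5 : node s5 c by rewrite eN5.
have := unlink_spec hs5 lr ec5 hc5 eV hw5; rewrite eA => /(_ hl5) done_.
apply: runs_weaken (runs_frame (c := unlink) isT done_) (leqnn _) _.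
move=> s6 [ht fr6]; split=> //.
  split; rewrite ?(frame_var fr6) //; first by rewrite (frame_var fr5).
    by rewrite (node_frame fr6) // eN5.
  by rewrite (frame_var fr5).
by rewrite (frame_var fr6) // (frame_var fr5) // (frame_var fr4).
Qed.

(** The loop test moved to natural numbers, where linear arithmetic decides it; the arguments are
    the weights below, at and above the pivot. *)
Definition off_center (b w a : nat) : bool :=
  ((b + w < a) || (a + w < b) || ((w == 0) && (0 < b + a)))%N.

Definition shift_test : bexpr :=
  ((below_ + med_~>tweight_ < above_)
         || (above_ + med_~>tweight_ < below_)
         || (med_~>tweight_ == Zero) && (Zero < below_ + above_))%prog.

Lemma test_shift V l r s m : pivot V l r m s ->
  fld s m tweight_ = Real (num x l r (pred1 (V m)))%:R ->
  test s shift_test = Some (off_center (num x l r (< V m))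
    (num x l r (pred1 (V m))) (num x l r (> V m))).
Proof.
move=> [em hm eb ea] ew; have hm' : (m < size (heap s))%N := hm.
rewrite /shift_test /off_center; simulate.
rewrite -!natrD !ler_nat -!ltnNge pnatr_eq0.
case: ltnP => //= _; case: ltnP => //= _; case: eqP => //= _.
by rewrite lern0 lt0n.
Qed.

(** A pivot of weight 0 passes the test only when both sides are empty, that is, for an empty
    histogram. *)
Lemma off_center_median l r y :
  off_center (num x l r (< y)) (num x l r (pred1 y)) (num x l r (> y)) = false
    ->
  is_median l r y /\ ((l < r) -> 0 < num x l r (pred1 y))%N.
Proof.
rewrite /off_center /is_median => h; have := num_trichotomy x l r y; lia.
Qed.

(* Weights being 1, a removal leaves the pivot at most one step away from a
   median node. *)
Lemma shift_spec V l r s m : hist V r s -> (l < r)%N ->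
  temporary V l.+1 r (alive V l r s) s -> pivot V l.+1 r m s ->
  env s dist_ = Real (dev x l.+1 r (V m)) ->
  is_median l r (V m) -> (0 < num x l r (pred1 (V m)))%N ->
  runs shift_median s 200 (fun s' => exists m',
    [/\ pivot V l.+1 r m' s', env s' dist_ = Real (dev x l.+1 r (V m')),
        is_median l.+1 r (V m') &
        ((l.+1 < r) -> 0 < num x l.+1 r (pred1 (V m')))%N]).
Proof.
move=> hs lr [hw hl] [em hm eb ea] ed [med1 med2] pos.
have cov : covers x l.+1 r (alive V l.+1 r s) V.
  move=> j /andP[lj jr]; have [k [hk ek _]] := hist_I hs jr; exists k => //.
  by rewrite /alive hk; apply/num_gt0P; exists j; rewrite ?lj //= ek.
(* The pivot was live before the removal, so its links are known even if it has just been unlinked,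
   and they lead to nodes still live. *)
have [[o eo ho] [p ep hp]] := hl m ltac:(by rewrite /alive hm).
have hm' : (m < size (heap s))%N := hm.
have ev := hist_val hs hm; have ew := hw m hm.
have cov' := covers_opp cov.
have := med1; have := med2; have := pos; rewrite !(num_ltn x _ lr) /=.
set b1 := num x l.+1 r (< V m); set w1 := num x l.+1 r (pred1 (V m)).
set a1 := num x l.+1 r (> V m).
(* The removed datum takes one unit from exactly one of the three weights. *)
have : ((x l < V m)%R + (x l == V m) + (V m < x l)%R = 1)%N by case: ltgtP.
set u1 := nat_of_bool (x l < V m); set u2 := nat_of_bool (x l == V m).
set u3 := nat_of_bool (V m < x l).
move=> u123 pos' low high.
(* The variant leaves room for one iteration: at 1 the loop has not run, at 0 the pivot passes the
   test. *)
pose J k s' := (k = 1%N /\ s' = s) \/ (k = 0%N /\ exists q,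
  [/\ pivot V l.+1 r q s', env s' dist_ = Real (dev x l.+1 r (V q)) &
     off_center (num x l.+1 r (< V q)) (num x l.+1 r (pred1 (V q)))
       (num x l.+1 r (> V q)) = false]).
rewrite /shift_median -/shift_test.
apply: (@runs_while _ _ _ _ J 100 1) => //; first by left.
move=> k s' [[-> ->]|[_ [q [hpv ed' hq]]]] fr; last first.
  exists false; split; last first.
    by have [? ?] := off_center_median hq; exists q.
  rewrite (test_shift hpv) ?hq // (frame_fld fr) ?hw //.
    by case: hpv => _; rewrite (node_frame fr).
  by case: hpv => _; rewrite (node_frame fr).
have hpv : pivot V l.+1 r m s by [].
exists (off_center b1 w1 a1); split; first by rewrite (test_shift hpv ew).
case: ifP => hoff; last by have [? ?] := off_center_median hoff; exists m.
have hw_node q : node s q -> fld s q tweight_ =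
    Real (num x l.+1 r (pred1 (V q)))%:R by exact: hw.
case: (leqP b1 a1) => hba.
- case: o eo ho => [q|] eo ho; last first.
    case: (nxt_none cov _ ho); move: hoff; rewrite -/a1 /off_center; lia.
  have [/andP[hq qpos] _ _] := ho.
  have hq' : (q < size (heap s))%N := hq.
  have evq := hist_val hs hq; have ewq := hw q hq.
  have elt := num_lt_nxt cov ho; have egt := num_gt_nxt cov ho.
  apply: runs_straight => //.
    by simulate; rewrite ler_nat hba /=; simulate.
  exists 0%N => //; right; split=> //; exists q; split.
  + split=> //=; first by rewrite elt natrD.
    by rewrite egt natrD addrK.
  + by rewrite /= (dev_nxt cov ho).
  (* By [high] and [u123] the right side exceeds [b1 + w1] by at most one, and the new pivot weighs
     at least one by [qpos]. A pivot of weight 0 with equal sides just moves onto a live node. *)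
  + by move: hoff; rewrite /off_center elt; lia.
- case: p ep hp => [q|] ep hp; last first.
    case: (nxt_none cov' _ hp); rewrite num_oppl -/b1; lia.
  have [/andP[hq qpos] _ _] := hp.
  have hq' : (q < size (heap s))%N := hq.
  have evq := hist_val hs hq; have ewq := hw q hq.
  (* The shift to the left is the shift to the right for the negated data. *)
  have := num_lt_nxt cov' hp; have := num_gt_nxt cov' hp.
  rewrite !num_oppl !num_oppr !num_opp_eq => elt egt.
  apply: runs_straight => //.
    by simulate; rewrite ler_nat leqNgt hba /=; simulate.
  exists 0%N => //; right; split=> //; exists q; split.
  + split=> //=; first by rewrite elt natrD addrK.
    by rewrite egt natrD.
  + have := dev_nxt cov' hp;
    rewrite !dev_opp !num_oppl !num_oppr num_opp_eq /= => ->.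
    by rewrite opprK [- V q + _]addrC.
  + by move: hoff; rewrite /off_center egt; lia.
Qed.

End Removal.

(** * The dynamic program *)

Section DynamicProgram.
Local Open Scope ring_scope.
Variables (R : realDomainType) (n : nat) (x : nat -> R) (gamma : R).
Implicit Types (s : store R) (V p : nat -> R) (A : pred nat).
Local Notation inputs := (inputs n x gamma).
Local Notation hist := (hist x).
Local Notation temporary := (temporary x).
Local Notation pivot := (pivot x).
Local Notation is_median := (is_median x).
Local Notation alive := (alive x).

(* [q] is the least cost of a segmentation of the first [r] data whose last
   block starts after the first [l'] data, [l' < l]; it is attained for [z]. *)
Definition best p l r (q : R) z : Prop :=
  [/\ (z < l)%N, exists2 j, (z <= j < r)%N & q = p z + gamma + dev x z r (x j) &
    forall l' y, (l' < l)%N -> q <= p l' + gamma + dev x l' r y].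

Definition progress p l r s : Prop :=
  if l == 0%N then cel s P_ r = Infinity
  else exists q z, [/\ cel s P_ r = Real q, cel s Z_ r.-1 = Idx z & best p l r
    q z].

Lemma eq_best p p' l r q z : (forall i, (i < l)%N -> p i = p' i) ->
  best p l r q z -> best p' l r q z.
Proof.
move=> e [zl [j hj ->] h]; split=> //; first by exists j; rewrite ?e.
by move=> l' y hl'; rewrite -[p' l']e // h.
Qed.

Lemma temporary_sub V l r A A' s : (forall k, A' k -> A k) ->
  temporary V l r A s -> temporary V l r A' s.
Proof. by move=> sub [hw hl]; split=> // k /sub; exact: hl. Qed.

Lemma temporary_frame c V l r A s s' : frame c s s' -> no_new c ->
  [&& ~~ writes_field c tweight_, ~~ writes_field c tnext_
    & ~~ writes_field c tprev_] -> (forall k, A k -> node s k) ->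
  temporary V l r A s -> temporary V l r A s'.
Proof.
move=> fr nn /and3P[cw cn cp] sub [hw hl]; have eN := node_frame fr nn.
split; rewrite eN; first by move=> k hk; rewrite (frame_fld fr) ?hw.
by apply: (linked_frame fr) => //; apply/andP.
Qed.

Lemma median_datum l r y : (0 < num x l r (pred1 y))%N ->
  exists2 j, (l <= j < r)%N & y = x j.
Proof. by move=> /num_gt0P[j hj /eqP <-]; exists j. Qed.

(** The median property bounds all levels on the newest block, and the positive count supplies the
    datum at which the cost is attained. *)
Lemma best_first p l r y : is_median l r y -> (0 < num x l r (pred1 y))%N ->
  (forall l' y', (l' < l)%N ->
     p l + gamma + dev x l r y <= p l' + gamma + dev x l' r y') ->
  best p l.+1 r (p l + gamma + dev x l r y) l.
Proof.
move=> [h1 h2] /median_datum[j hj ey] least; split=> //; first by exists j;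
  rewrite -?ey.
move=> l' y'; rewrite ltnS leq_eqVlt => /predU1P[->|/least//].
by rewrite lerD2l; exact: dev_median.
Qed.

Lemma best_keep p l r y q z : is_median l r y -> best p l r q z ->
  q <= p l + gamma + dev x l r y -> best p l.+1 r q z.
Proof.
move=> [h1 h2] [zl hj h] hq; split=> //; first exact: ltnW.
move=> l' y'; rewrite ltnS leq_eqVlt => /predU1P[->|/h//].
by apply: le_trans hq _; rewrite lerD2l; exact: dev_median.
Qed.

Definition update_best : cmd :=
  (If (cand_ <= P_.[r_]) (
        P_.[r_] <~ cand_ ;;
        Z_.[r_ - 1%N] <~ l_ - 1%N
      ) Skip)%prog.

Lemma update_best_spec p l r s y : inputs s -> (l < r)%N -> (r <= n)%N ->
  env s l_ = Idx l.+1 -> env s r_ = Idx r ->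
  env s cand_ = Real (p l + gamma + dev x l r y) ->
  is_median l r y -> (0 < num x l r (pred1 y))%N -> progress p l r s ->
  runs update_best s 50 (fun s' => [/\ progress p l.+1 r s',
    forall i, i != r -> cel s' P_ i = cel s P_ i &
    forall i, i != r.-1 -> cel s' Z_ i = cel s Z_ i]).
Proof.
move=> inp lr rn el er ec med pos hp.
have hP : (r < size (arrays s P_))%N by rewrite (in_size inp) addn1.
have hZ : (r.-1 < size (arrays s Z_))%N by rewrite (in_size inp) addn0; lia.
have r1 : (r - 1 = r.-1)%N by lia.
set c := p l + gamma + dev x l r y in ec *.
pose s1 := set_cel (set_cel s P_ r (Real c)) Z_ r.-1 (Idx l).
have ok : straight s (P_.[r_] <~ cand_ ;;
  Z_.[r_ - 1%N] <~ l_ - 1%N)%prog = Some s1.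
  by simulate; rewrite r1; simulate.
have s1_ok : (forall l' y', (l' < l)%N ->
    p l + gamma + dev x l r y <= p l' + gamma + dev x l' r y') ->
    [/\ progress p l.+1 r s1, forall i, i != r -> cel s1 P_ i = cel s P_ i &
    forall i, i != r.-1 -> cel s1 Z_ i = cel s Z_ i].
  have hZ' : (r.-1 < size (arrays (set_cel s P_ r (Real c)) Z_))%N.
    by rewrite size_set_cel.
  move=> least; split.
  - exists c, l; split; last exact: best_first.
      by rewrite !cel_set_cel //= eqxx.
    by rewrite !cel_set_cel //= eqxx.
  - by move=> i /negPf hi; rewrite !cel_set_cel //= hi.
  - by move=> i /negPf hi; rewrite !cel_set_cel //= hi.
move: hp; rewrite /progress; case: eqP => [l0 ePr|_ [q [z [eq_ ez hbest]]]].
  apply: (@runs_if _ _ _ _ _ 30 _ _ true) => //; first by simulate.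
  by apply: runs_straight ok _ _ => //; apply: s1_ok => l' y'; rewrite l0.
apply: (@runs_if _ _ _ _ _ 30 _ _ (c <= q)) => //; first by simulate.
case: leP => hcq.
  apply: runs_straight ok _ _ => //; apply: s1_ok => l' y' hl'.
  by apply: le_trans hcq _; have [_ _] := hbest; apply.
apply: (@runs_straight _ _ _ s) => //; split=> //; exists q, z; split=> //.
by apply: best_keep med hbest _; exact: ltW.
Qed.

Definition inner_body : cmd :=
  (cand_ <~ P_.[l_ - 1%N] + gamma_ + dist_ ;;
      update_best ;;
      remove_datum ;;
      shift_median)%prog.

(** [s0] is the store at the start of the scan, with which the entries of [Z_] for shorter prefixes
    are compared. The pivot has weight only while [l < r]: the last removal empties the
    histogram. *)
Definition scanned p V l r s0 s : Prop :=
  [/\ temporary V l r (alive V l r s) s,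
    exists m, [/\ pivot V l r m s, env s dist_ = Real (dev x l r (V m)),
      is_median l r (V m) & (l < r -> 0 < num x l r (pred1 (V m)))%N],
    forall i, (i < r)%N -> cel s P_ i = Real (p i),
    progress p l r s &
    forall i, i != r.-1 -> cel s Z_ i = cel s0 Z_ i].

Lemma scanned_set_l p V l r s0 s v :
  scanned p V l r s0 s -> scanned p V l r s0 (set_var s l_ v).
Proof.
case=> [[hw hl] [m [[em hm eb ea] ed med pos]] hP hpr hZ]; split=> //.
by exists m; split.
Qed.

Lemma inner_body_spec p V l r s0 s : inputs s -> hist V r s -> (l < r)%N ->
  (r <= n)%N -> env s l_ = Idx l.+1 -> env s r_ = Idx r ->
  scanned p V l r s0 s -> runs inner_body s 1000 (scanned p V l.+1 r s0).
Proof.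
move=> inp hs lr rn el er [ht [m [hpv ed med pos]] hP hpr hZ].
have lP : (l < size (arrays s P_))%N by rewrite (in_size inp) addn1 ltnS
  (leq_trans (ltnW lr)).
have ePl := hP l lr; have eg := in_gamma inp.
apply: runs_step => //; first by simulate.
set s1 := set_var s cand_ _ => fr1.
have inp1 := inputs_frame fr1 isT inp; have hs1 := hist_frame fr1 isT isT hs.
have := update_best_spec (s := s1) inp1 lr rn el er erefl med (pos lr) hpr.
move=> H; apply: (runs_seq (T2 := 500) _ H) => // s2 fr2 [hpr2 hP2 hZ2].
have inp2 := inputs_frame fr2 isT inp1; have hs2 := hist_frame fr2 isT isT hs1.
have fr12 := frame_seq fr1 fr2.
have el2 : env s2 l_ = Idx l.+1 by rewrite (frame_var fr12).
have hpv2 : pivot V l r m s2.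
  by case: hpv => *; split; rewrite ?(node_frame fr12) ?(frame_var fr12).
have ed2 : env s2 dist_ = Real (dev x l r (V m)) by rewrite (frame_var fr12).
have ht2 : temporary V l r (alive V l r s2) s2.
  rewrite (alive_frame _ _ _ _ fr12) //;
    apply: temporary_frame fr12 _ _ _ ht => // k.
  by case/andP.
have := remove_spec inp2 hs2 lr rn el2 ht2 hpv2 ed2.
move=> {}H; apply: (runs_seq (T2 := 200) _ H) => // s3 fr3 [ht3 hpv3 ed3].
have inp3 := inputs_frame fr3 isT inp2; have hs3 := hist_frame fr3 isT isT hs2.
rewrite -(alive_frame _ _ _ _ fr3) // in ht3.
have {}H := shift_spec hs3 lr ht3 hpv3 ed3 med (pos lr).
apply: runs_weaken (runs_frame (c := shift_median) isT H) (leqnn _) _.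
move=> s4 [hm4 fr4].
have fr34 := frame_seq fr3 fr4.
split=> //.
(* With the pivot back on a live node, the links may be restricted to the nodes still live; a node
   just removed is dropped here. *)
- have sub k : alive V l.+1 r s3 k -> alive V l r s3 k.
    by rewrite /alive (num_ltn _ _ lr) => /andP[-> h]; rewrite addn_gt0 h orbT.
  rewrite (alive_frame _ _ _ _ fr4) //;
    apply: temporary_frame fr4 _ _ _ _ => //.
    by move=> k /andP[].
  exact: temporary_sub sub ht3.
- by move=> i ir; rewrite /cel (frame_arr fr34) // -/(cel _ _ _) hP2 ?ltn_eqF
  //; exact: hP.
- by move: hpr2; rewrite /progress /cel !(frame_arr fr34).
- by move=> i ir; rewrite /cel (frame_arr fr34) // -/(cel _ _ _) hZ2 //;
  exact: hZ.
Qed.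

Definition dp p k s : Prop :=
  [/\ p 0%N = - gamma, forall i, (i <= k)%N -> cel s P_ i = Real (p i) &
    forall i, (0 < i <= k)%N ->
      exists2 z, cel s Z_ i.-1 = Idx z & best p i i (p i) z].

Definition outer_body : cmd :=
  (P_.[r_] <~ Infty ;;
    insert_datum ;;
    reset_temporary ;;
    find_median ;;
    sum_distances ;;
    For l_ 1%N r_ inner_body)%prog.

Lemma outer_body_spec V p r s : inputs s -> (r < n)%N -> env s r_ = Idx r.+1 ->
  hist V r s -> dp p r s ->
  runs outer_body s (3000 * n) (fun s' =>
    exists V' p', hist V' r.+1 s' /\ dp p' r.+1 s').
Proof.
move=> inp rn er hs [p0 hP hZ].
have hrP : (r.+1 < size (arrays s P_))%N by rewrite (in_size inp) addn1.
apply: (@runs_step _ _ _ _ (set_cel s P_ r.+1 Infinity)) => //=;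
  [by simulate| |by lia].
set s1 := set_cel _ _ _ _ => fr1.
have inp1 := inputs_frame fr1 isT inp; have hs1 := hist_frame fr1 isT isT hs.
have er1 : env s1 r_ = Idx r.+1 by rewrite (frame_var fr1).
have ePr : cel s1 P_ r.+1 = Infinity by rewrite cel_set_cel //= eqxx.
have hP1 i : (i <= r)%N -> cel s1 P_ i = Real (p i).
  by move=> ir; rewrite cel_set_cel //= ltn_eqF ?hP.
have hZ1 i : cel s1 Z_ i = cel s Z_ i by rewrite cel_set_cel.
clearbody s1.
(* [T2] is the time left after each phase. The insertion takes [200 * r.+1] and the three traversals
   [100 * r.+2] each, where [r < n]. *)
apply: (runs_seq (T2 := (2500 * n)%N) _ (insert_spec inp1 hs1 rn er1)) => //=;
  last by lia.
move=> s2 fr2 [V' hs2]; have inp2 := inputs_frame fr2 isT inp1.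
apply: (runs_seq (T2 := (2300 * n)%N) _ (reset_spec hs2)) => //=; last by lia.
move=> s3 fr3 [ht3 et3].
have inp3 := inputs_frame fr3 isT inp2; have hs3 := hist_frame fr3 isT isT hs2.
apply: (runs_seq (T2 := (2000 * n)%N) _ (find_median_spec hs3 isT et3)) =>
  //=; last by lia.
move=> s4 fr4 [m hpv4 med4].
have inp4 := inputs_frame fr4 isT inp3; have hs4 := hist_frame fr4 isT isT hs3.
have [em4 hm4 _ _] := hpv4.
apply: (runs_seq (T2 := (1800 * n)%N) _ (sum_distances_spec hs4 hm4 em4)) =>
  //=; last by lia.
move=> s5 fr5 ed5.
have inp5 := inputs_frame fr5 isT inp4; have hs5 := hist_frame fr5 isT isT hs4.
have fr45 := frame_seq fr4 fr5; have fr25 := frame_seq fr2 (frame_seq fr3 fr45).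
have er5 : env s5 r_ = Idx r.+1 by rewrite (frame_var fr25).
have scan0 : scanned p V' 0 r.+1 s5 s5.
  split.
  - have sub k : alive V' 0 r.+1 s5 k -> node s3 k.
      by rewrite /alive (node_frame fr45) // => /andP[].
    apply: temporary_frame fr45 _ _ _ (temporary_sub sub _) => //.
    by rewrite (node_frame fr3).
  - exists m; split=> //.
      by case: hpv4 => *; split; rewrite ?(node_frame fr5) ?(frame_var fr5).
    by move=> _; exact: hist_pos hs4 _ hm4.
  - by move=> i ir; rewrite /cel (frame_arr fr25) //; exact: hP1.
  - by rewrite /progress /= /cel (frame_arr fr25).
  - by [].
(* The counter is 1-based: when it equals [k], the number of data removed is [k.-1]. *)
apply: (@runs_for _ _ _ _ _ _ 1 r.+1 (fun k =>
  scanned p V' k.-1 r.+1 s5) 1000) => //.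
- exact: scanned_set_l.
- move=> [//|l] s' _ lr hscan el' er' fr.
  have inp' := inputs_frame fr isT inp5; have hs' := hist_frame fr isT isT hs5.
  apply: runs_weaken (inner_body_spec inp' hs' lr rn el' er' hscan) (leqnn _) _
    => s6 h6.
  exact: scanned_set_l.
- move=> s6 /= [_ _ hP6 hpr hZ6] fr6.
  have hs6 := hist_frame fr6 isT isT hs5.
  have {hpr} [q [z [eq_ ez hbest]]] := hpr.
  (* The table changes at the new argument only; [best] looks at strictly smaller ones, so the
     earlier entries survive. *)
  exists V', (upd p r.+1 q); split=> //.
  have pE i : (i < r.+1)%N -> p i = upd p r.+1 q i by move=> h /=;
    rewrite ltn_eqF.
  split=> [|i|i]; first by rewrite -pE.
    rewrite leq_eqVlt => /predU1P[->|ir]; first by rewrite /= eqxx.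
    by rewrite hP6 // pE.
  move=> /andP[i0]; rewrite leq_eqVlt => /predU1P[->|ir].
    by exists z => //=; rewrite eqxx; apply: eq_best hbest.
  have [|z' ez' hb'] := hZ i; first by rewrite i0.
  exists z'; last by rewrite -pE //; apply: eq_best hb' => j ji;
    rewrite pE // (ltn_trans ji).
  rewrite hZ6; last by rewrite /=; case: (i) i0 ir => //= j _ ir;
    rewrite ltn_eqF.
  by rewrite /cel (frame_arr fr25) // -/(cel _ _ _) hZ1.
- by rewrite /=; lia.
Qed.

Lemma hist_empty V s : heap s = [::] -> env s head_ = Ptr None -> hist V 0 s.
Proof.
move=> h0 eh; have no k : node s k = false by rewrite /node h0.
split; rewrite ?h0 //; try by move=> k; rewrite no.
- by move=> k k'; rewrite -topredE /= no.
- by exists None => // k; rewrite no.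
Qed.

Lemma compute_spec s : inputs s -> (0 < n)%N -> heap s = [::] ->
  runs compute_P_Z s (3100 * n ^ 2)
    (fun s' => (size (heap s') <= n)%N /\ exists p, dp p n s').
Proof.
move=> inp n0 hheap; have eg := in_gamma inp; have en := in_n inp.
have hP : (0 < size (arrays s P_))%N by rewrite (in_size inp) addn1.
have n2 : (n <= n ^ 2)%N by rewrite -mulnn leq_pmulr.
apply: (@runs_step _ _ _ _ (set_cel s P_ 0 (Real (0 - gamma)))) => //=;
  [by simulate| |by lia].
set s1 := set_cel _ _ _ _ => fr1.
apply: (@runs_step _ _ _ _ (set_var s1 head_ (Ptr None))) => //= [fr2|];
  last by lia.
set s2 := set_var _ _ _ in fr2 *.
have fr12 := frame_seq fr1 fr2.
have inp2 := inputs_frame fr12 isT inp.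
have eN : size (heap s2) = 0%N by rewrite (frame_no_new fr12) // hheap.
pose I k s' := exists V p, hist V k.-1 s' /\ dp p k.-1 s'.
apply: (@runs_for _ _ _ _ _ _ 1 n I (3000 * n)%N) => //=.
- exists (fun=> 0), (fun=> - gamma); split; first by apply: hist_empty.
  by split=> // [[|//] _|[]//];
    rewrite /s2 /s1 !cel_set_var cel_set_cel // !eqxx /= sub0r.
- move=> [//|k] s' _ kn [V [p [hs hdp]]] er en' fr.
  have inp' := inputs_frame fr isT inp2.
  apply: runs_weaken (outer_body_spec inp' kn er hs hdp) (leqnn _) _ => s3.
  move=> [V' [p' [hs' hdp']]]; exists V', p'; split=> //.
  by case: hs'.
- move=> s' [V [p [hs hdp]]] fr; split; first exact: hist_size hs.
  by exists p.
- have : (n * (3000 * n + 9) = 3000 * n ^ 2 + 9 * n)%N by rewrite -mulnn; lia.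
  by lia.
Qed.

End DynamicProgram.

(** * Reconstruction *)

Section Reconstruction.
Local Open Scope ring_scope.
Variables (R : realDomainType) (n : nat) (x : nat -> R) (gamma : R).
Implicit Types (s : store R) (p u : nat -> R).
Local Notation inputs := (inputs n x gamma).
Local Notation dp := (dp x gamma).

Definition distance_loop : cmd :=
  (For j_ (lo_ + 1%N) hi_ (
      dist_ <~ dist_ + W_.[j_ - 1%N] * `|F_.[j_ - 1%N] - F_.[i_ - 1%N]|))%prog.

Lemma distance_loop_spec lo hi i s : inputs s -> (lo <= hi <= n)%N ->
  (i < n)%N -> env s lo_ = Idx lo -> env s hi_ = Idx hi ->
  env s i_ = Idx i.+1 -> env s dist_ = Real 0 ->
  runs distance_loop s (60 * (hi - lo) + 20)
    (fun s' => env s' dist_ = Real (dev x lo hi (x i))).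
Proof.
move=> inp /andP[lohi hin] iN elo ehi ei ed.
apply: (@runs_for _ _ _ _ _ _ lo.+1 hi
  (fun k s' => env s' dist_ = Real (dev x lo k.-1 (x i))) 30) => //=.
- by simulate; rewrite addn1.
- by rewrite dev_empty.
- move=> [//|k] s' lok khi ed' ej _ fr.
  have inp' := inputs_frame fr isT inp.
  have ei' : env s' i_ = Idx i.+1 by rewrite (frame_var fr).
  have kn : (k < n)%N := leq_trans khi hin.
  have hF a : (a < n)%N -> (a < size (arrays s' F_))%N by rewrite (in_size
    inp') addn0.
  have hF1 := hF k kn; have hF2 := hF i iN.
  have hW : (k < size (arrays s' W_))%N by rewrite (in_size inp') addn0.
  have eFk := in_F inp' kn; have eFi := in_F inp' iN; have eW := in_W inp' kn.
  apply: runs_straight => //; first by simulate.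
  by rewrite /= mul1r dev_recr.
- by lia.
Qed.

(** Minimality among the data suffices, because the cost recorded by [best] is attained at a datum.
    The time is quadratic in the block length; one factor is relaxed to [n] for the amortization. *)
Lemma block_median_spec lo hi s : inputs s -> (lo < hi)%N -> (hi <= n)%N ->
  env s lo_ = Idx lo -> env s hi_ = Idx hi ->
  runs block_median s (300 * (hi - lo) * n) (fun s' => exists2 y,
    env s' argbest_ = Real y &
    forall j, (lo <= j < hi)%N -> dev x lo hi y <= dev x lo hi (x j)).
Proof.
move=> inp lohi hin elo ehi.
have bn : (hi - lo <= n)%N by lia.
apply: (@runs_step _ _ _ _ (set_var s best_ Infinity)) => //= [fr0|];
  last by nia.
set s1 := set_var s _ _ in fr0 *.
(* [best_] is infinite only before the first datum, so a nonempty block leaves a real in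
   [argbest_]. *)
pose I k s' := if (k == lo.+1)%N then env s' best_ = Infinity else exists y,
  [/\ env s' best_ = Real (dev x lo hi y), env s' argbest_ = Real y &
      forall j, (lo <= j < k.-1)%N -> dev x lo hi y <= dev x lo hi (x j)].
rewrite -/distance_loop.
apply: (@runs_for _ _ _ _ _ _ lo.+1 hi I (60 * (hi - lo) + 100)) => //=.
- by simulate; rewrite addn1.
- exact: ltnW.
- by rewrite /I eqxx.
- move=> [//|i] s' loi ihi hI ei _ fr.
  have fr1 := frame_seq fr0 fr.
  have inp' := inputs_frame fr1 isT inp.
  have iN : (i < n)%N := leq_trans ihi hin.
  have hF : (i < size (arrays s' F_))%N by rewrite (in_size inp') addn0.
  have eF := in_F inp' iN.
  pose s2 := set_var s' dist_ (Real 0).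
  apply: (@runs_step _ _ _ _ s2) => //= [fr2|]; last by lia.
  have inp2 := inputs_frame fr2 isT inp'.
  have elo2 : env s2 lo_ = Idx lo by rewrite (frame_var fr2) // (frame_var fr1).
  have ehi2 : env s2 hi_ = Idx hi by rewrite (frame_var fr2) // (frame_var fr1).
  have lohin : (lo <= hi <= n)%N by rewrite ltnW.
  have dl := distance_loop_spec inp2 lohin iN elo2 ehi2 ei erefl.
  apply: (runs_seq (T2 := 60) _ dl) => //=; last by lia.
  move=> s3 fr3 ed3; have fr23 := frame_seq fr2 fr3.
  have inp3 := inputs_frame fr3 isT inp2.
  have ei3 : env s3 i_ = Idx i.+1 by rewrite (frame_var fr23).
  have {}hF : (i < size (arrays s3 F_))%N by rewrite (in_size inp3) addn0.
  have {}eF := in_F inp3 iN.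
  have eb3 : env s3 best_ = env s' best_ by rewrite (frame_var fr23).
  have ea3 : env s3 argbest_ = env s' argbest_ by rewrite (frame_var fr23).
  have hb : straight s3 (best_ <~ dist_ ;;
    argbest_ <~ F_.[i_ - 1%N])%prog = Some
      (set_var (set_var s3 best_ (Real (dev x lo hi (x i)))) argbest_ (Real (x
        i))).
    by simulate.
  move: hI; rewrite {1}/I eqSS; case: eqP => [eil|nil].
    move=> eb'; rewrite eb' in eb3.
    apply: (@runs_if _ _ _ _ _ 30 _ _ true) => //; first by simulate.
    apply: runs_straight hb _ _ => //.
    rewrite /I eqSS gtn_eqF /=; last by rewrite eil.
    by exists (x i); split=> // j; rewrite eil ltnS -eqn_leq => /eqP ->.
  move=> [y [eb' ea' least]]; rewrite eb' in eb3; rewrite ea' in ea3.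
  apply: (@runs_if _ _ _ _ _ 30 _ _ (dev x lo hi (x i) < dev x lo hi y)) => //.
    by simulate; rewrite -ltNge.
  case: ltP => hlt.
    apply: runs_straight hb _ _ => //.
    rewrite /I eqSS gtn_eqF //=; exists (x i); split=> // j /andP[lj].
    rewrite ltnS leq_eqVlt => /predU1P[->//|ji].
    by rewrite (le_trans (ltW hlt)) // least ?lj.
  apply: (@runs_straight _ _ _ s3) => //.
  rewrite /I eqSS gtn_eqF //=; exists y; split=> // j /andP[lj].
  rewrite ltnS leq_eqVlt => /predU1P[->//|ji].
  by rewrite least ?lj.
- move=> s' + _; rewrite /I eqSS gtn_eqF // => -[y [_ ea least]].
  by exists y.
- by nia.
Qed.

Definition jump_count u k : nat := (\sum_(k <= i < n.-1) (u i != u i.+1))%N.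

(** The last term charges the opening of the leftmost block, as the recursion does; at [k = 0] it is
    cancelled by P_0 = -gamma. *)
Definition tail_cost u k : R := \sum_(k <= j < n) `|u j - x j|
  + gamma * (jump_count u k)%:R + gamma * (k < n)%:R.

(** There is no jump inside the new block and at most one at its right border, none if the next
    block has the same level or if the block is the last. *)
Lemma jump_count_block u k l y : (k < n)%N -> (l <= k)%N ->
  (jump_count (fun j => if (j < k.+1)%N then y else u j) l
     <= jump_count u k.+1 + (k.+1 < n))%N.
Proof.
move=> kn lk; rewrite /jump_count (@big_cat_nat _ _ _ k) //=; last by lia.
rewrite big_nat big1 ?add0n => [|i /andP[_ ik]]; last first.
  by rewrite !ltnS (ltnW ik) ik eqxx.
case: (ltnP k.+1 n) => kn'; last by rewrite big_geq //; lia.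
rewrite big_ltn; last by lia.
rewrite addnC leq_add ?leq_b1 //.
apply/eq_leq/eq_big_nat => i /andP[ki _].
by rewrite ltnNge ki ltnNge leqW.
Qed.

Lemma tail_cost_block u k l y : 0 <= gamma -> (k < n)%N -> (l <= k)%N ->
  tail_cost (fun j => if (j < k.+1)%N then y else u j) l
    <= tail_cost u k.+1 + gamma + dev x l k.+1 y.
Proof.
move=> g0 kn lk; rewrite /tail_cost (@big_cat_nat _ _ _ k.+1) //=;
  last exact: leqW.
rewrite (leq_ltn_trans lk kn) mulr1.
have -> : \sum_(l <= i < k.+1) `|(if (i < k.+1)%N then y else u i) - x i| =
    dev x l k.+1 y.
  by apply: eq_big_nat => i /andP[_ ->]; rewrite distrC.
have -> : \sum_(k.+1 <= i < n) `|(if (i < k.+1)%N then y else u i) - x i| =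
    \sum_(k.+1 <= i < n) `|u i - x i|.
  by apply: eq_big_nat => i /andP[ki _]; rewrite ltnNge ki.
have := jump_count_block u y kn lk; rewrite -(ler_nat R) natrD.
by move=> /(ler_wpM2l g0); rewrite mulrDr; lra.
Qed.

Definition fill : cmd :=
  (For i_ (lo_ + 1%N) hi_ (U_.[i_ - 1%N] <~ argbest_))%prog.

Lemma fill_spec lo hi s y : inputs s -> (lo < hi <= n)%N ->
  env s lo_ = Idx lo -> env s hi_ = Idx hi -> env s argbest_ = Real y ->
  runs fill s (60 * (hi - lo) + 20) (fun s' => forall j, (lo <= j)%N ->
    cel s' U_ j = if (j < hi)%N then Real y else cel s U_ j).
Proof.
move=> inp /andP[lohi hin] elo ehi ey.
pose I k s' := forall j, (lo <= j)%N ->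
  cel s' U_ j = if (j < k.-1)%N then Real y else cel s U_ j.
apply: (@runs_for _ _ _ _ _ _ lo.+1 hi I 30) => //=.
- by simulate; rewrite addn1.
- exact: ltnW.
- by move=> j lj; rewrite /= ltnNge lj.
- move=> [//|k] s' lok khi hI ei _ fr.
  have inp' := inputs_frame fr isT inp.
  have ey' : env s' argbest_ = Real y by rewrite (frame_var fr).
  have hU : (k < size (arrays s' U_))%N by rewrite (in_size inp') addn0; lia.
  apply: runs_straight => //; first by simulate.
  move=> j lj; rewrite cel_set_var cel_set_cel //= hI //= ltnS.
  by case: ltngtP.
- by lia.
Qed.

Lemma reconstruct_spec p s : 0 <= gamma -> inputs s -> (0 < n)%N -> dp p n s ->
  runs reconstruct s (1000 * n ^ 2) (fun s' => exists2 u,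
    forall j, (j < n)%N -> cel s' U_ j = Real (u j) &
    \sum_(0 <= j < n) `|u j - x j| + gamma * (jump_count u 0)%:R <= p n).
Proof.
move=> g0 inp n0 [p0 hP hZ]; have en := in_n inp.
have n2 : (n <= n ^ 2)%N by rewrite -mulnn leq_pmulr.
apply: (@runs_step _ _ _ _ (set_var s hi_ (Idx n))) => //= [|fr0|];
  [by simulate| |by lia].
set s1 := set_var s _ _ in fr0 *.
pose J k s' := [/\ env s' hi_ = Idx k, (k <= n)%N & exists2 u,
  forall j, (k <= j < n)%N -> cel s' U_ j = Real (u j) &
  tail_cost u k + p k <= p n].
rewrite -/fill.
(* A charge of [600 * n] per datum of a block makes the time proportional to the decrease of [hi_];
   the blocks together have [n] data. *)
apply: (@runs_while_amortized _ _ _ _ J (600 * n) n) => //.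
- split=> //; exists (fun=> 0); first by move=> j; lia.
  by rewrite /tail_cost /jump_count !big_geq ?leq_pred // ltnn !mulr0 !add0r.
- move=> k s' [ehi kn [u hu hcost]] fr.
  exists (0 < k)%N; split; first by simulate; rewrite -ltnNge.
  case: k ehi kn hu hcost => [|k] ehi kn hu hcost /=.
    exists u => //; move: hcost; rewrite /tail_cost n0 p0 mulr1; lra.
  have fr1 := frame_seq fr0 fr.
  have inp' := inputs_frame fr1 isT inp.
  have [|z ez [zk [j0 hj0 ep] _]] := hZ k.+1; first by rewrite kn.
  have ez' : cel s' Z_ k = Idx z by rewrite /cel (frame_arr fr1).
  have hz : (k < size (arrays s' Z_))%N by rewrite (in_size inp') addn0.
  exists (600 * n * (k.+1 - z))%N.
  have b1 : (1 <= (k.+1 - z) * n)%N by rewrite muln_gt0 subn_gt0 zk.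
  have b2 : ((k.+1 - z) <= (k.+1 - z) * n)%N by rewrite leq_pmulr.
  have e600 a : (a * n * (k.+1 - z) = a * ((k.+1 - z) * n))%N by rewrite -mulnA
    (mulnC n).
  apply: runs_step => //; [by simulate| |by rewrite /= e600; lia].
  set s2 := set_var s' lo_ _ => fr2.
  have inp2 := inputs_frame fr2 isT inp'.
  have bm := block_median_spec (s := s2) inp2 zk kn erefl ehi.
  apply: (runs_seq (T2 := (200 * ((k.+1 - z) * n))%N) _ bm) => //; last first.
    by rewrite /= e600 -mulnA; lia.
  move=> s3 fr3 [y ey least].
  have inp3 := inputs_frame fr3 isT inp2.
  have fr23 := frame_seq fr2 fr3.
  have elo3 : env s3 lo_ = Idx z by rewrite (frame_var fr3).
  have ehi3 : env s3 hi_ = Idx k.+1 by rewrite (frame_var fr23).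
  have zkn : (z < k.+1 <= n)%N by rewrite zk.
  have fl := fill_spec inp3 zkn elo3 ehi3 ey.
  apply: (runs_seq (T2 := 20) _ fl) => //; last by lia.
  move=> s4 fr4 hU.
  have elo4 : env s4 lo_ = Idx z by rewrite (frame_var fr4).
  apply: runs_straight => //.
  exists z; split=> //; split=> //; first exact: leq_trans (ltnW zk) kn.
  exists (fun j => if (j < k.+1)%N then y else u j).
    move=> j /andP[zj jn]; rewrite cel_set_var hU //; case: ltnP => // kj.
    by rewrite /cel (frame_arr fr23) // -/(cel _ _ _) hu // kj.
  (* The level [y] does at least as well as the datum of index [j0], at which the recorded cost of
     the prefix is attained. *)
  have := tail_cost_block u y g0 kn (zk : (z <= k)%N).
  by have := least j0 hj0; move: hcost; rewrite ep; lra.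
- by rewrite /= -mulnn in n2 *; nia.
Qed.

(** The last block of a prefix of [v] is kept open at level [v k]. It is extended while [v] is
    constant; at a jump the optimality of [p] closes it and a new block starts. *)
Lemma dp_lower_bound p s (v : nat -> R) : dp p n s -> (0 < n)%N ->
  p n <= \sum_(0 <= j < n) `|v j - x j| + gamma * (jump_count v 0)%:R.
Proof.
move=> [p0 _ hZ] n0.
have opt i l y : (0 < i <= n)%N -> (l < i)%N -> p i <= p l + gamma + dev x l i
  y.
  by move=> /hZ[z _ [_ _ h]] li; exact: h.
have prefix k : (k < n)%N -> exists2 l, (l <= k)%N &
    p l + gamma + dev x l k.+1 (v k) <=
    \sum_(0 <= j < k.+1) `|v j - x j| +
      gamma * (\sum_(0 <= i < k) (v i != v i.+1))%:R.
  elim: k => [|k IH] kn.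
    exists 0%N => //; rewrite p0 [X in X%:R]big_geq // mulr0 addr0 addNr add0r.
    by rewrite dev_recr // dev_empty big_nat1 add0r distrC.
  have [l lk hl] := IH (ltnW kn).
  rewrite big_nat_recr //= [in (_ * _)%R]big_nat_recr //=.
  case: eqP => [e|ne] /=.
    exists l; first exact: leqW.
    rewrite addn0 dev_recr; last exact: leqW.
    by rewrite -e distrC; move: hl; lra.
  exists k.+1 => //; have := opt k.+1 l (v k); rewrite (ltnW kn) => /(_ isT lk).
  rewrite [dev x k.+1 k.+2 _]dev_recr // dev_empty natrD mulrDr mulr1 distrC.
  by move: hl; lra.
have [l ln hl] := prefix n.-1 (ltac:(by rewrite prednK)).
rewrite (prednK n0) in hl.
by apply: le_trans (opt n l (v n.-1) _ _) hl; lia.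
Qed.

End Reconstruction.

(** * Optimality, time and space of the whole program *)

Section Main.
Local Open Scope ring_scope.
Variable R : realDomainType.
Implicit Types (s : store R) (n : nat).

Definition datum n (f : 'rV[R]_n) (j : nat) : R :=
  if insub j is Some i then f 0 i else 0.

Lemma datumE n (f : 'rV[R]_n) (i : 'I_n) : datum f i = f 0 i.
Proof. by rewrite /datum valK. Qed.

Lemma size_real_cells n (f : 'rV[R]_n) : size (real_cells f) = n.
Proof. by rewrite size_map size_enum_ord. Qed.

Lemma nth_real_cells n (f : 'rV[R]_n) j : (j < n)%N ->
  nth (Ptr None) (real_cells f) j = Real (datum f j).
Proof.
move=> jn; rewrite -[j]/(nat_of_ord (Ordinal jn)) datumE.
by rewrite (nth_map (Ordinal jn)) ?size_enum_ord // nth_ord_enum.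
Qed.

(** The last position has no right neighbour and contributes nothing, which accounts for the bound
    [n.-1]. *)
Lemma jumps_count n (v : 'rV[R]_n) : jumps v = jump_count n (datum v) 0.
Proof.
rewrite /jumps /jump_count -sum1dep_card big_mkcond.
case: n v => [|n] v; first by rewrite big_ord0 big_geq.
rewrite big_ord_recr /= big_mkord [X in (_ + X)%N](_ : _ = 0%N) ?addn0;
  last first.
  by case: existsP => // -[j /andP[/eqP jn]]; have := ltn_ord j;
    rewrite jn ltnn.
apply: eq_bigr => i _.
have e1 : datum v i = v 0 (widen_ord (leqnSn n) i) by rewrite -datumE.
have e2 : datum v i.+1 = v 0 (lift ord0 i) by rewrite -datumE.
rewrite e1 e2; case: existsP => [[j /andP[/eqP ji ne]]|no].
  have <- : j = lift ord0 i by apply: val_inj.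
  by rewrite ne.
case: (eqVneq (v 0 _)) => //= ne; case: no.
by exists (lift ord0 i); rewrite eqxx.
Qed.

Lemma potts_sum n (gamma : R) (f v : 'rV[R]_n) : potts_L1 gamma f v =
  \sum_(0 <= j < n) `|datum v j - datum f j| +
    gamma * (jump_count n (datum v) 0)%:R.
Proof.
rewrite /potts_L1 jumps_count addrC big_mkord; congr (_ + _).
by apply: eq_bigr => i _; rewrite !datumE.
Qed.

Definition allocated n (f : 'rV[R]_n) (gamma : R) : store R :=
  set_arr (set_arr (set_arr (set_arr (input_store f (const_mx 1) gamma)
    P_ (nseq (n + 1) (Ptr None))) Z_ (nseq n (Ptr None))) I_ (nseq n (Ptr
      None)))
    U_ (nseq n (Ptr None)).

Lemma allocated_inputs n (f : 'rV[R]_n) gamma :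
  inputs n (datum f) gamma (allocated f gamma).
Proof.
split=> //.
- by case; rewrite /= ?size_nseq ?size_real_cells ?addn0.
- by move=> j jn; rewrite /cel /= nth_real_cells.
- by move=> j jn; rewrite /cel /= nth_real_cells // -[j]/(nat_of_ord (Ordinal
  jn)) datumE mxE.
Qed.

(** 21 variables, six arrays of [n] cells with one more in [P_], and seven fields in each of at most
    [n] nodes. *)
Lemma space_inputs n x gamma s : inputs n x gamma s -> (size (heap s) <= n)%N ->
  (space s <= 22 + 13 * n)%N.
Proof.
move=> inp hs; rewrite /space (eq_bigr _ (fun a _ => in_size inp a)).
by rewrite /= !big_cons big_nil /=; lia.
Qed.

(** Allocation lies outside [frame] and is executed by hand: [n + 5] units for [P_] and [n + 2] for
    each of the other three arrays, with an empty heap throughout. *)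
Lemma exec_allocation n (f : 'rV[R]_n) gamma c s t m :
  exec c (allocated f gamma) s t m ->
  exists m', exec (Alloc P_ (n_ + 1%N) ;; Alloc Z_ n_ ;; Alloc I_ n_ ;;
                   Alloc U_ n_ ;; c)%prog
    (input_store f (const_mx 1) gamma) s (4 * n + 11 + t) m' /\
    (m' <= maxn (22 + 13 * n) m)%N.
Proof.
move=> E; eexists; split.
  have -> : (4 * n + 11 + t = (3 + (n + 1)).+1 + ((1 + n).+1 + ((1 + n).+1 +
    ((1 + n).+1 + t))))%N by lia.
  do 4 (apply: ExecSeq; first by apply: ExecAlloc).
  exact: E.
by rewrite /space !big_cons !big_nil /= ?size_nseq ?size_real_cells; lia.
Qed.

End Main.

Local Open Scope ring_scope.

Theorem corollary3p4 (R : realType) :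
  exists C : nat, forall (n : nat) (f : 'rV[R]_n) (gamma : R),
    (0 < n)%N -> 0 < gamma ->
    exists (u : 'rV[R]_n) (s : store R) (time mem : nat),
      [/\ exec potts_algorithm (input_store f (const_mx 1) gamma) s time mem,
          output s u,
          (forall v : 'rV[R]_n, potts_L1 gamma f u <= potts_L1 gamma f v),
          (time <= C * n ^ 2)%N
        & (mem <= C * n)%N].
Proof.
(* The two phases take 3100 + 1000 times [n ^ 2], and the [4 * n + 11] of the allocations is at most
   [15 * n ^ 2]. *)
exists 4200%N => n f gamma n0 g0.
have inp0 := allocated_inputs f gamma.
have n2 : (n <= n ^ 2)%N by rewrite -mulnn leq_pmulr.
have noA1 : no_alloc compute_P_Z by [].
have [s1 [t1 [m1 [E1 ht1 [hs1 [p hdp]]]]]] := compute_spec inp0 n0 erefl.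
have fr1 := exec_frame noA1 E1; have inp1 := inputs_frame fr1 isT inp0.
have [s2 [t2 [m2 [E2 ht2 [w hw hcost]]]]] := reconstruct_spec (ltW g0) inp1 n0
  hdp.
have noA2 : no_alloc reconstruct by [].
have fr2 := exec_frame noA2 E2; have inp2 := inputs_frame fr2 isT inp1.
have E12 := ExecSeq E1 E2.
have [m [E hm]] := exec_allocation E12.
pose u : 'rV[R]_n := \row_i w i.
have uE j : (j < n)%N -> datum u j = w j.
  by move=> jn; rewrite -[j]/(nat_of_ord (Ordinal jn)) datumE mxE.
exists u, s2, (4 * n + 11 + (t1 + t2))%N, m; split=> //.
- apply: (@eq_from_nth _ (Ptr None)); rewrite (in_size inp2) addn0.
    by rewrite size_real_cells.
  by move=> j jn; rewrite nth_real_cells // uE //; exact: hw.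
(* The value [p n] separates the cost of [u] from that of any [v]; what remains is to identify [u]
   with the function [w] read off [U_]. *)
- move=> v; rewrite !potts_sum; apply: le_trans (dp_lower_bound _ hdp n0).
  apply: le_trans hcost; rewrite le_eqVlt; apply/orP; left; apply/eqP.
  congr (_ + gamma * _%:R); first by apply: eq_big_nat => j jn; rewrite uE.
  by apply: eq_big_nat => j /andP[_ jn]; rewrite !uE //; lia.
- by lia.
- apply: leq_trans hm _; have h2 := space_inputs inp2.
  have h1 := space_inputs inp1 hs1.
  have h3 : (size (heap s2) <= n)%N by rewrite (frame_no_new fr2).
  have m1s := exec_mem noA1 E1; have m2s := exec_mem noA2 E2.
  have := h2 h3; lia.
Qed.
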